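(* Let $P$ be the uniform distribution on the closed unit disc $D=\{(x_1,x_2)\in\mathbb R^2: x_1^2+x_2^2\le 1\}$. Assume that for every optimal set of three-means $\alpha$ for $P$, the Voronoi regions of the three points of $\alpha$ partition $D$ into three sectors each subtending a central angle of $\frac{2\pi}{3}$ radians. Then there are uncountably many optimal sets of three-means for $P$, the quantization error is $V_3(P)=0.196036$ (decimal approximation, i.e. $|V_3(P)-0.196036|<10^{-6}$), and the three points of any optimal set of three-means form an equilateral triangle inscribed in the circle $x_1^2+x_2^2=\frac{3}{\pi^2}$.
   Context: The uniform distribution on $D$ is the Borel probability measure with density $\frac1\pi$ on $D$ and $0$ elsewhere with respect to Lebesgue measure. For a Borel probability measure $P$ on $\mathbb R^d$ and $n\ge1$, the $n$th quantization error is $V_n(P)=\inf\{\int \min_{a\in\alpha}\|x-a\|^2\,dP(x):\alpha\subset\mathbb R^d,\ \mathrm{card}(\alpha)\le n\}$, where $\|\cdot\|$ is the Euclidean norm. A set $\alpha$ with $\mathrm{card}(\alpha)\le n$ attaining the infimum is called an optimal set of $n$-means; for absolutely continuous $P$ it has exactly $n$ elements. For finite $\alpha\subset\mathbb R^d$ and $a\in\alpha$, the Voronoi region of $a$ is $M(a|\alpha)=\{x\in\mathbb R^d:\|x-a\|=\min_{b\in\alpha}\|x-b\|\}$. ''Partition'' is understood up to boundaries of Lebesgue measure zero. *)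

(* Defs.v *)
From HB Require Import structures.
From mathcomp Require Import all_boot all_order all_algebra finmap.
From mathcomp Require Import all_classical all_reals all_analysis
  measurable_realfun.
From mathcomp Require Import ring lra.
Import Order.TTheory GRing.Theory Num.Theory.
Import numFieldNormedType.Exports.

Set Implicit Arguments.
Unset Strict Implicit.
Unset Printing Implicit Defensive.

Local Open Scope classical_set_scope.
Local Open Scope ring_scope.

Section geometry.
Context {R : realType}.
Implicit Types (x a : R * R) (alpha : {fset R * R}).

(* The canonical norm of the product type R * R is the sup norm, hence this
   explicit Euclidean norm. *)
Definition enorm x : R := Num.sqrt (x.1 ^+ 2 + x.2 ^+ 2).

Definition unit_disc : set (R * R) := [set x | x.1 ^+ 2 + x.2 ^+ 2 <= 1].

(* The minimum is taken in \bar R only to have a neutral element; it is a real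
   number as soon as alpha is nonempty. *)
Definition voronoi alpha a : set (R * R) :=
  [set x | (enorm (x - a))%:E
           = \big[Order.min/+oo%E]_(b <- alpha) (enorm (x - b))%:E].

Definition sector (theta phi : R) : set (R * R) :=
  [set x | exists r t, [/\ 0 <= r <= 1, theta <= t <= theta + phi
                         & x = (r * cos t, r * sin t)]].

Definition lebesgue2 := (@lebesgue_measure R \x @lebesgue_measure R)%E.

(* Voronoi regions and sectors are both closed: the pieces cover the disc
   exactly and overlap only in null sets.  The vertex of a sector is the origin, the
   centre of the disc; angles are in radians. *)
Definition voronoi_sector_partition (phi : R) alpha : Prop :=
  [/\ \bigcup_(a in [set` alpha]) (voronoi alpha a `&` unit_disc) = unit_disc,
      forall a b, a \in alpha -> b \in alpha -> a != b ->
        lebesgue2 (voronoi alpha a `&` voronoi alpha b `&` unit_disc) = 0%E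
    & forall a, a \in alpha ->
        exists theta, voronoi alpha a `&` unit_disc = sector theta phi].

Definition equilateral_triangle alpha : Prop :=
  #|` alpha| = 3%N /\
  exists s : R, forall a b, a \in alpha -> b \in alpha -> a != b ->
    enorm (a - b) = s.

Definition inscribed_in_circle (rho2 : R) alpha : Prop :=
  forall a, a \in alpha -> a.1 ^+ 2 + a.2 ^+ 2 = rho2.

End geometry.

Section quantization.
Context {R : realType} (P : probability (R * R)%type R) (n : nat).
Implicit Types alpha : {fset R * R}.

(* For empty alpha the integrand is +oo, so that the empty set never competes
   in the infimum below. *)
Definition distortion alpha : \bar R :=
  (\int[P]_x \big[Order.min/+oo]_(a <- alpha) (enorm (x - a) ^+ 2)%:E)%E.

Definition quantization_error : \bar R :=
  ereal_inf [set distortion alpha | alpha in [set alpha | (#|` alpha| <= n)%N]].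

Definition optimal_means alpha : Prop :=
  (#|` alpha| <= n)%N /\ distortion alpha = quantization_error.

End quantization.

Section uniform_disc.
Context {R : realType}.
Local Notation mu := (@lebesgue_measure R).

Definition disc_pdf (x : R * R) : R := pi^-1 * \1_unit_disc x.

Definition uniform_disc : set (R * R) -> \bar R :=
  fun A => (\int[@lebesgue2 R]_(x in A) (disc_pdf x)%:E)%E.

Lemma measurable_unit_disc : measurable (@unit_disc R).
Proof.
have mf : measurable_fun setT (fun x : R * R => x.1 ^+ 2 + x.2 ^+ 2).
  by apply: measurable_funD; apply: measurable_funX;
    [exact: measurable_fst|exact: measurable_snd].
have -> : @unit_disc R =
    setT `&` (fun x : R * R => x.1 ^+ 2 + x.2 ^+ 2) @^-1` `]-oo, 1].
  by rewrite setTI; apply/seteqP; split => x /=; rewrite in_itv.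
exact: mf.
Qed.

Lemma disc_pdf_ge0 x : 0 <= disc_pdf x.
Proof. by rewrite mulr_ge0// invr_ge0 pi_ge0. Qed.

Lemma measurable_disc_pdf : measurable_fun setT disc_pdf.
Proof.
by apply: measurable_funM => //; apply: measurable_indic;
  exact: measurable_unit_disc.
Qed.

Let chord (x : R) : R := Num.sqrt (1 - x ^+ 2).

Let chord_section x : mu (xsection (@unit_disc R) x) = (chord x *+ 2)%:E.
Proof.
have [x1|x1] := leP (x ^+ 2) 1.
  have -> : xsection (@unit_disc R) x = `[- chord x, chord x]%classic.
    apply/seteqP; split => y /=.
      rewrite /xsection/= inE /unit_disc/= -lerBrDl => xy.
      by rewrite in_itv/= -ler_norml -sqrtr_sqr ler_sqrt// subr_ge0.
    rewrite in_itv/= -ler_norml -sqrtr_sqr ler_sqrt ?subr_ge0// => xy.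
    by rewrite /xsection/= inE /unit_disc/= -lerBrDl.
  rewrite lebesgue_measure_itv/= lte_fin.
  case: ltP => [_|cN]; first by rewrite -EFinD opprK -mulr2n.
  have := sqrtr_ge0 (1 - x ^+ 2); rewrite -/(chord x) => c0.
  by congr EFin; lra.
have -> : chord x = 0 by apply: ler0_sqrtr; rewrite subr_le0 ltW.
rewrite mul0rn; have -> : xsection (@unit_disc R) x = set0; last exact: measure0.
apply/seteqP; split => y //=; rewrite /xsection/= inE /unit_disc/= => xy.
by move: x1; rewrite ltNge => /negP; apply; apply: le_trans xy; rewrite lerDl sqr_ge0.
Qed.

Let integral_chord : (\int[mu]_(x in `[(-1)%R, 1%R]) (chord x *+ 2)%:E = (pi : R)%:E)%E.
Proof.
have Npp : - (pi / 2) < pi / 2 :> R.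
  by rewrite gtrN// divr_gt0// pi_gt0.
have dsin : derive1 (@sin R) = cos by apply/funext => x; rewrite derive1E derive_val.
have -> : `[(-1 : R), 1]%classic = `[sin (- (pi / 2)), sin (pi / 2)]%classic.
  by rewrite sinN sin_pihalf.
rewrite (@integration_by_substitution_increasing R (@sin R) (fun x => chord x *+ 2)) //; last 7 first.
- by apply: ltW.
- by move=> x y xI yI xy; rewrite ltr_sin.
- by move=> x _; rewrite dsin; exact: continuous_cos.
- by rewrite dsin; apply/cvg_ex; exists (cos (- (pi / 2)));
    apply: cvg_at_right_filter; exact: continuous_cos.
- by rewrite dsin; apply/cvg_ex; exists (cos (pi / 2));
    apply: cvg_at_left_filter; exact: continuous_cos.
- split; first by move=> x _; exact: ex_derive.
  + by apply: cvg_at_right_filter; exact: continuous_sin.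
  + by apply: cvg_at_left_filter; exact: continuous_sin.
- apply: continuous_subspaceT => x; rewrite /chord.
  have -> : (fun x : R => Num.sqrt (1 - x ^+ 2) *+ 2) =
     (fun x => Num.sqrt (1 - x * x) * 2) by apply/funext => y; rewrite expr2 mulr_natr.
  apply: cvgM; last exact: cvg_cst.
  apply: continuous_comp; last exact: sqrt_continuous.
  by apply: cvgB; [exact: cvg_cst|apply: cvgM; exact: cvg_id].
transitivity (\int[mu]_(t in `[(- (pi / 2))%R, (pi / 2)%R]) (2 * cos t ^+ 2)%:E)%E.
  apply: eq_integral.
  move=> t; rewrite inE/= in_itv/= => tI.
  rewrite -[LHS]/((chord (sin t) *+ 2 * derive1 (@sin R) t)%:E).
  rewrite dsin /chord -cos2sin2 sqrtr_sqr ger0_norm ?cos_ge0_pihalf//.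
  by congr EFin; ring.
pose F (t : R) := t + sin t * cos t.
have dF (t : R) : is_derive t (1 : R) F (2 * cos t ^+ 2).
  apply: is_derive_eq; rewrite /GRing.scale/=.
  by have := cos2Dsin2 t; lra.
have cF : continuous F.
  by move=> t; apply/differentiable_continuous/derivable1_diffP; exact: ex_derive.
rewrite (@continuous_FTC2 _ _ F)//; last 3 first.
- apply: continuous_subspaceT => t.
  apply: cvgM; first exact: cvg_cst.
  by apply: cvgM; exact: continuous_cos.
- split; first by move=> x _; exact: ex_derive.
  + by apply: cvg_at_right_filter; exact: cF.
  + by apply: cvg_at_left_filter; exact: cF.
- by move=> t _; rewrite derive1E derive_val.
rewrite /F cosN cos_pihalf !mulr0 !addr0 -EFinD opprK.
by congr EFin; rewrite -splitr.
Qed.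

Lemma lebesgue2_unit_disc : lebesgue2 (@unit_disc R) = (pi : R)%:E.
Proof.
rewrite /lebesgue2 /product_measure1 -integral_chord [RHS]integral_mkcond.
apply: eq_integral => x _; rewrite /= chord_section patchE.
case: ifPn => // /negP xI; congr EFin.
rewrite [chord x]ler0_sqrtr ?mul0rn// subr_le0 leNgt; apply/negP => x1.
by apply: xI; rewrite inE/= in_itv/=; apply/andP; split; nra.
Qed.

Let uniform_disc0 : uniform_disc set0 = 0%E.
Proof. by rewrite /uniform_disc integral_set0. Qed.

Let uniform_disc_ge0 A : (0 <= uniform_disc A)%E.
Proof. by apply: integral_ge0 => x _; rewrite lee_fin disc_pdf_ge0. Qed.

Let uniform_disc_sigma_additive : semi_sigma_additive uniform_disc.
Proof.
move=> F mF tF mUF; rewrite /uniform_disc; apply: cvg_toP.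
  apply: ereal_nondecreasing_is_cvgn => m n mn.
  apply: lee_sum_nneg_natr => // k _ _.
  exact: uniform_disc_ge0.
rewrite ge0_integral_bigcup//=.
- apply: measurable_funTS; apply: measurableT_comp => //.
  exact: measurable_disc_pdf.
- by move=> x _; rewrite lee_fin disc_pdf_ge0.
Qed.

HB.instance Definition _ := isMeasure.Build _ _ _ uniform_disc
  uniform_disc0 uniform_disc_ge0 uniform_disc_sigma_additive.

Let uniform_disc_setT : uniform_disc [set: _] = 1%E.
Proof.
transitivity
    ((pi^-1 : R)%:E * \int[@lebesgue2 R]_x (\1_(@unit_disc R) x)%:E)%E.
  apply: (@integralZl_indic _ _ R (@lebesgue2 R) _ measurableT
            (fun=> @unit_disc R) pi^-1).
    by move=> /lt_geF; rewrite invr_ge0 pi_ge0.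
  exact: measurable_unit_disc.
rewrite integral_indic//; last exact: measurable_unit_disc.
by rewrite setIT [X in (_ * X)%E]lebesgue2_unit_disc -EFinM mulVf// gt_eqF// pi_gt0.
Qed.

HB.instance Definition _ := @Measure_isProbability.Build _ _ R
  uniform_disc uniform_disc_setT.

End uniform_disc.

(* Main.v *)
Require Import Defs.
From mathcomp Require Import all_boot all_order all_algebra finmap.
From mathcomp Require Import all_classical all_reals all_analysis.
From mathcomp Require Import measurable_realfun ring lra.
Import Order.TTheory GRing.Theory Num.Theory.
Import numFieldNormedType.Exports.
Local Open Scope classical_set_scope.
Local Open Scope ring_scope.

(* Write a closed 2pi/3-sector of D with axis u (|u| = 1) as the wedge
   {x in D | |x| <= 2 <x, u>}.  Rotation invariance of the planar Lebesgue measure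
   and Fubini give its first moment (sqrt 3 / 3) u.  By compactness an optimal set
   {a, b, c} exists; its Voronoi cells are wedges with axes u, v, w.  Splitting the
   integral of |x - z|^2 over D along these cells, for all z, gives area pi/3 and
   second moment pi/6 for each wedge, and u + v + w = 0.  Hence, with
   r = sqrt 3 / pi, the distortion of {a, b, c} is
     1/2 - 3/pi^2 + (|a - r u|^2 + |b - r v|^2 + |c - r w|^2) / 3.
   Every equilateral triangle centred at 0 with circumradius r has distortion at
   most 1/2 - 3/pi^2, because three wedges around its vertices cover D.  So
   a = r u, b = r v, c = r w, and all these triangles are optimal. *)

(** * Trigonometry and bounds on pi *)

(** The assumption constrains optimal sets only, so it yields nothing until one is known to exist;
    hence the compactness argument. One optimal set then also serves as a computing device: cutting
    D along its cells gives an identity valid for every z, both sides are quadratic polynomials in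
    z, and equality of coefficients yields the area and the second moment of a wedge together with
    the balance of the axes. Only the first moment takes an actual integration over the wedge.
    Angles disappear once sectors have become wedges: unit vectors and u + v + w = 0 carry the
    geometry from there on. Rotation invariance comes from shears, which Fubini reduces to
    translations of the line. For the decimal value, pi / 6 is compared with rationals through sin
    (pi / 6) = 1/2, where a few Taylor terms suffice. *)

Section trig.
Context {R : realType}.
Implicit Types x : R.

Lemma cos_pithird : cos (pi / 3) = 2^-1 :> R.
Proof.
have E : (pi / 3 : R) *+ 2 = pi - pi / 3 by lra.
have h : cos (pi / 3 : R) ^+ 2 *+ 2 - 1 = - cos (pi / 3).
  by rewrite -cos_mulr2n E cosB cospi sinpi mul0r addr0 mulN1r.
have p : 0 < cos (pi / 3 : R).
  by apply: cos_gt0_pihalf; have := @pi_gt0 R => ?; lra.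
(* Doubling the angle gives 2 c^2 + c - 1 = 0, and positivity excludes the root -1. *)
have : (2 * cos (pi / 3 : R) - 1) * (cos (pi / 3 : R) + 1) = 0 by lra.
by move/eqP; rewrite mulf_eq0 => /orP[]/eqP ?; lra.
Qed.

Lemma sin_pisixth : sin (pi / 6) = 2^-1 :> R.
Proof.
rewrite -cos_pithird -cosBpihalf -cosN; congr cos; lra.
Qed.

Lemma ge0_of_derive {f : R -> R} (f' : R -> R) :
  (forall t : R, is_derive t (1 : R) f (f' t)) -> (forall t, 0 <= t -> 0 <= f' t) ->
  0 <= f 0 -> forall t, 0 <= t -> 0 <= f t.
Proof.
move=> df f'0 f0 t t0; apply: (le_trans f0).
apply: (@ger0_derive1_le_cc _ f 0 t) => //.
- move=> u; rewrite in_itv/= => /andP[u0 _].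
  by rewrite derive1E (@derive_val _ _ _ _ _ _ _ (df u)) f'0 ?ltW.
- apply: continuous_subspaceT => u.
  by apply/differentiable_continuous/derivable1_diffP; exact: (@ex_derive _ _ _ _ _ _ _ (df u)).
- by rewrite in_itv/= lexx.
- by rewrite in_itv/= lexx t0.
Qed.

Definition cos_taylor n (t : R) := \sum_(i < n) ((-1) ^+ i / (2 * i)`!%:R * t ^+ (2 * i)).
Definition sin_taylor n (t : R) := \sum_(i < n) ((-1) ^+ i / (2 * i).+1`!%:R * t ^+ (2 * i).+1).

Lemma is_derive_monomial (c : R) n (t : R) :
  is_derive t (1 : R) (fun t => c / n.+1`!%:R * t ^+ n.+1) (c / n`!%:R * t ^+ n).
Proof.
have -> : (fun t : R => c / n.+1`!%:R * t ^+ n.+1) = (c / n.+1`!%:R) *: (id ^+ n.+1 : R -> R).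
  by apply/funext => x; rewrite /= !fctE.
have -> : c / n`!%:R * t ^+ n = (c / n.+1`!%:R) *: ((n.+1%:R * (id : R -> R) t ^+ n) *: (1 : R)).
  rewrite /GRing.scale/= factS natrM; field.
  by rewrite pnatr_eq0 -lt0n fact_gt0 -(natrD _ 1) pnatr_eq0.
by apply: is_deriveZ; apply: is_deriveX.
Qed.

Lemma is_derive_sin_taylor n (t : R) : is_derive t (1:R) (sin_taylor n) (cos_taylor n t).
Proof.
have -> : sin_taylor n = \sum_(i < n) (fun t => (-1) ^+ i / (2 * i).+1`!%:R * t ^+ (2 * i).+1).
  by apply/funext => x; rewrite fct_sumE.
by apply: is_derive_sum => i; exact: is_derive_monomial.
Qed.

Lemma is_derive_cos_taylor n (t : R) : is_derive t (1:R) (cos_taylor n.+1) (- sin_taylor n t).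
Proof.
have -> : cos_taylor n.+1 =
    cst 1 + \sum_(i < n) (fun t => (-1) ^+ i.+1 / (2 * i).+2`!%:R * t ^+ (2 * i).+2).
  apply/funext => x; rewrite /cos_taylor big_ord_recl/= fctE fct_sumE; congr (_ + _).
    by rewrite muln0 fact0 expr0 invr1 !mulr1.
  by apply: eq_bigr => i _; rewrite /bump/= add1n mulnS add2n.
rewrite -[- sin_taylor n t]add0r /sin_taylor -sumrN.
apply: is_deriveD; apply: is_derive_sum => i.
by rewrite -!mulNr -[- (-1) ^+ i]mulN1r -exprS; exact: is_derive_monomial.
Qed.

(** Sine and cosine alternate in the induction: each inequality is, up to sign, the derivative of
    the next one, and both sides agree at 0. It starts from cos <= 1; the sign is that of the first
    omitted term. *)
Lemma taylor_alternate n : forall x, 0 <= x ->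
  0 <= (-1) ^+ n.+1 * (cos x - cos_taylor n.+1 x) /\
  0 <= (-1) ^+ n.+1 * (sin x - sin_taylor n.+1 x).
Proof.
have sin_step m : (forall x, 0 <= x -> 0 <= (-1) ^+ m * (cos x - cos_taylor m x)) ->
    forall x, 0 <= x -> 0 <= (-1) ^+ m * (sin x - sin_taylor m x).
  move=> cge0; apply: (ge0_of_derive _ _ cge0) => [t|].
    have d : is_derive t (1 : R) ((-1) ^+ m *: (@sin R - sin_taylor m))
        ((-1) ^+ m *: (cos t - cos_taylor m t)).
      by apply: is_deriveZ; apply: is_deriveB; exact: is_derive_sin_taylor.
    exact: d.
  by rewrite sin0 /sin_taylor big1 ?subr0 ?mulr0// => i _; rewrite expr0n/= mulr0.
have cos_step m : (forall x, 0 <= x -> 0 <= (-1) ^+ m * (sin x - sin_taylor m x)) ->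
    forall x, 0 <= x -> 0 <= (-1) ^+ m.+1 * (cos x - cos_taylor m.+1 x).
  move=> sge0.
  apply: (@ge0_of_derive _
    (fun x => (-1) ^+ m.+1 * (- sin x - - sin_taylor m x))) => [t|t t0|].
  - have d : is_derive t (1 : R) ((-1) ^+ m.+1 *: (@cos R - cos_taylor m.+1))
        ((-1) ^+ m.+1 *: (- sin t - - sin_taylor m t)).
      by apply: is_deriveZ; apply: is_deriveB; exact: is_derive_cos_taylor.
    exact: d.
  - by rewrite exprS mulN1r -opprD mulrNN; exact: sge0.
  - rewrite cos0 /cos_taylor big_ord_recl big1 => [|i _].
      by rewrite expr0 fact0 divr1 mulr1 addr0 subrr mulr0.
    by rewrite expr0n/= mulr0.
elim: n => [|n IH].
  have c1 x : 0 <= x -> 0 <= (-1) ^+ 1 * (cos x - cos_taylor 1 x).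
    move=> _; rewrite /cos_taylor big_ord1 expr0 fact0 divr1 mulr1 expr1 mulN1r opprB.
    by rewrite subr_ge0 cos_le1.
  by move=> x x0; split; [exact: c1|exact: sin_step].
have cn : forall x, 0 <= x -> 0 <= (-1) ^+ n.+2 * (cos x - cos_taylor n.+2 x).
  by apply: cos_step => x /IH[].
by move=> x x0; split; [exact: cn|exact: sin_step].
Qed.

Lemma sin_taylor_bounds x : 0 <= x -> sin_taylor 4 x <= sin x <= sin_taylor 5 x.
Proof.
move=> x0; have [_] := taylor_alternate 3 x x0; have [_] := taylor_alternate 4 x x0.
rewrite [_ ^+ 5]exprS -[_ ^+ 4]signr_odd/= expr0 mul1r mulr1 mulN1r oppr_ge0.
by rewrite subr_le0 subr_ge0 => -> ->.
Qed.

(** The successive factorial ratios are 2*3, 4*5, 6*7 and 8*9, so in Horner form no large factorial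
    appears as a numeral. *)
Lemma sin_taylor_horner x :
  sin_taylor 4 x = x * (1 - x ^+ 2 / 6 * (1 - x ^+ 2 / 20 * (1 - x ^+ 2 / 42))) /\
  sin_taylor 5 x =
    x * (1 - x ^+ 2 / 6 * (1 - x ^+ 2 / 20 * (1 - x ^+ 2 / 42 * (1 - x ^+ 2 / 72)))).
Proof.
have f1 : 1`!%:R = 1 :> R by [].
have f3 : 3`!%:R = 6 :> R by [].
have f5 : 5`!%:R = 6 * 20 :> R by rewrite 2!factS mulnA natrM mulrC -f3.
have f7 : 7`!%:R = 6 * 20 * 42 :> R by rewrite 2!factS mulnA natrM mulrC -f5.
have f9 : 9`!%:R = 6 * 20 * 42 * 72 :> R by rewrite 2!factS mulnA natrM mulrC -f7.
rewrite /sin_taylor !big_ord_recr !big_ord0/= -[(2 * 0).+1]/1%N -[(2 * 1).+1]/3%N.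
rewrite -[(2 * 2).+1]/5%N -[(2 * 3).+1]/7%N -[(2 * 4).+1]/9%N f1 f3 f5 f7 f9.
by split; field.
Qed.

(* Large decimal numerals would be expanded in unary, hence the split constants. *)
Lemma pi_bounds :
  6 * (523 / 10 ^+ 3 + 598 / 10 ^+ 6) < (pi : R) < 6 * (523 / 10 ^+ 3 + 599 / 10 ^+ 6).
Proof.
have pi0 := @pi_gt0 R; have p2 := @pihalf_lt2 R; have p1 := @pihalf_ge1 R.
have mem (c : R) : 0 <= c <= 2 / 3 -> c \in `[- (pi / 2), pi / 2].
  by move=> /andP[c0 c4]; rewrite in_itv/=; apply/andP; split; lra.
have pm : (pi : R) / 6 \in `[- (pi / 2), pi / 2] by apply: mem; apply/andP; split; lra.
set a : R := _ + 598 / _; set b : R := _ + 599 / _.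
suff /andP[pa pb] : a < pi / 6 < b.
  by clearbody a b; apply/andP; split; lra.
have am : a \in `[- (pi / 2), pi / 2] by apply: mem; rewrite /a; apply/andP; split; lra.
have bm : b \in `[- (pi / 2), pi / 2] by apply: mem; rewrite /b; apply/andP; split; lra.
(* Sine is increasing on this interval, so the goal becomes sin a < 1/2 < sin b: five Taylor terms
   bound sin a from above, four bound sin b from below. *)
rewrite -(ltr_sin am pm) -(ltr_sin pm bm) sin_pisixth.
have /sin_taylor_bounds/andP[_ /le_lt_trans ->] : 0 <= a by rewrite /a; lra.
  have /sin_taylor_bounds/andP[+ _] : 0 <= b by rewrite /b; lra.
  apply: lt_le_trans; rewrite (sin_taylor_horner _).1 /b.
  lra.
rewrite (sin_taylor_horner _).2 /a. lra.
Qed.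

(** The angle is acos (x / r) with the sign of y. The range [-pi, pi] is the one on which
    [cos_ge_half] can be applied. *)
Lemma polar_coordinates (x y : R) : exists2 t, -pi <= t <= pi &
  x = Num.sqrt (x ^+ 2 + y ^+ 2) * cos t /\ y = Num.sqrt (x ^+ 2 + y ^+ 2) * sin t.
Proof.
set r := Num.sqrt _.
have r2 : r ^+ 2 = x ^+ 2 + y ^+ 2 by rewrite sqr_sqrtr// addr_ge0// sqr_ge0.
have r0 : 0 <= r by exact: sqrtr_ge0.
have pi0 := @pi_gt0 R.
have [r00|rn0] := eqVneq r 0.
  have xy0 : x ^+ 2 + y ^+ 2 = 0 by rewrite -r2 r00 expr0n.
  have x0 : x = 0 by apply/eqP; rewrite -sqrf_eq0; apply/eqP; nra.
  have y0 : y = 0 by apply/eqP; rewrite -sqrf_eq0; apply/eqP; nra.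
  by exists 0; rewrite ?r00 ?x0 ?y0 ?mul0r//; apply/andP; split; lra.
have {r0} r0 : 0 < r by rewrite lt_neqAle eq_sym rn0.
have c1 : -1 <= x / r <= 1.
  rewrite ler_pdivlMr// ler_pdivrMr// mul1r mulN1r -ler_norml.
  by rewrite -sqrtr_sqr ler_wsqrtr// lerDl sqr_ge0.
have ac := @acosK R _ c1.
have p0 := acos_ge0 c1; have p1 := acos_lepi c1.
have sr : r * sin (acos (x / r)) = `|y|.
  rewrite sin_acos// -sqrtr_sqr.
  have -> : r * Num.sqrt (1 - (x / r) ^+ 2) = Num.sqrt (r ^+ 2 * (1 - (x / r) ^+ 2)).
    by rewrite sqrtrM ?sqr_ge0// sqrtr_sqr ger0_norm// ltW.
  by congr Num.sqrt; rewrite mulrBr mulr1 -exprMn [r * _]mulrC divfK// r2; ring.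
have [y0|y0] := leP 0 y.
  exists (acos (x / r)); first by apply/andP; split; lra.
  by rewrite sr ger0_norm// ac mulrC divfK.
exists (- acos (x / r)); first by apply/andP; split; lra.
by rewrite cosN sinN mulrN sr ltr0_norm// opprK ac mulrC divfK.
Qed.

Lemma cos_ge_half (t : R) : -pi <= t <= pi ->
  (2^-1 <= cos t) = (- (pi / 3) <= t <= pi / 3).
Proof.
move=> /andP[tl tu]; have pi0 := @pi_gt0 R.
rewrite -cos_pithird -(cos_norm t) -ler_norml leNgt [RHS]leNgt ltr_cos//.
  by rewrite in_itv/=; apply/andP; split; lra.
by rewrite in_itv/= normr_ge0/= ler_norml; apply/andP; split; lra.
Qed.

Definition dotp (x y : R * R) : R := x.1 * y.1 + x.2 * y.2.

Definition wedge (u : R * R) : set (R * R) :=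
  [set x | x.1 ^+ 2 + x.2 ^+ 2 <= 1 /\ enorm x <= 2 * dotp x u].

(** The axis bisects the sector. For a point at angle s from the axis, the wedge inequality reads
    cos s >= 1/2, that is |s| <= pi / 3. *)
Lemma sectorE theta : sector theta (2 * pi / 3) =
  wedge (cos (theta + pi / 3), sin (theta + pi / 3)) :> set (R * R).
Proof.
have pi0 := @pi_gt0 R; set p := theta + pi / 3.
apply/seteqP; split => [_ [r [t [/andP[r0 r1] /andP[t0 t1] ->]]]|].
  have cs : (r * cos t) ^+ 2 + (r * sin t) ^+ 2 = r ^+ 2.
    by have := cos2Dsin2 t => e; rewrite !exprMn -mulrDr e mulr1.
  split => /=; first by rewrite cs expr_le1.
  rewrite /enorm /dotp/= cs sqrtr_sqr ger0_norm// -!mulrA -mulrDr -cosB.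
  have : 2^-1 <= cos (t - p).
    by rewrite cos_ge_half /p; apply/andP; split; lra.
  nra.
move=> [x y] []/=; rewrite /enorm /dotp/= => xy1 xyp.
have cs := cos2Dsin2 p.
(* Polar coordinates in the frame turned by [p], whose first coordinate is the scalar product with
   the axis. *)
have [s sI [ex ey]] := polar_coordinates (x * cos p + y * sin p) (y * cos p - x * sin p).
have : (x * cos p + y * sin p) ^+ 2 + (y * cos p - x * sin p) ^+ 2 = x ^+ 2 + y ^+ 2.
  transitivity ((x ^+ 2 + y ^+ 2) * (cos p ^+ 2 + sin p ^+ 2)); first ring.
  by rewrite cs mulr1.
move=> n2; rewrite {}n2 in ex ey.
set r := Num.sqrt _ in xyp ex ey.
have r0 : 0 <= r by exact: sqrtr_ge0.
have r1 : r <= 1 by rewrite -sqrtr1 ler_wsqrtr.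
have ex' : x = r * cos (p + s).
  transitivity (cos p * (r * cos s) - sin p * (r * sin s)); last by rewrite cosD; ring.
  by rewrite -ex -ey -[LHS]mulr1 -cs; ring.
have ey' : y = r * sin (p + s).
  transitivity (sin p * (r * cos s) + cos p * (r * sin s)); last by rewrite sinD; ring.
  by rewrite -ex -ey -[LHS]mulr1 -cs; ring.
(* At the origin the wedge inequality does not constrain [s], so the angle [theta] is taken
   instead. *)
have [r00|rn0] := eqVneq r 0.
  exists 0, theta; split; rewrite ?lexx ?ler01//; first by apply/andP; split; lra.
  by rewrite ex' ey' r00 !mul0r.
have {rn0} rp : 0 < r by rewrite lt_neqAle eq_sym rn0.
exists r, (p + s); split; [by rewrite r0| |by rewrite -ex' -ey'].
have : 2^-1 <= cos s by rewrite -(ler_pM2l rp); move: xyp; rewrite ex; lra.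
by rewrite cos_ge_half// => /andP[]; rewrite /p => ? ?; apply/andP; split; lra.
Qed.

End trig.

(** * Rotation invariance of the planar Lebesgue measure *)

Section invariance.
Context {R : realType}.
Local Notation mu := (@lebesgue_measure R).
Local Notation mu2 := (@lebesgue2 R).

Lemma lebesgue_measure_shift (c : R) (A : set R) : measurable A ->
  pushforward mu (fun x : R => x + c) A = mu A.
Proof.
have mf : measurable_fun setT (fun x : measurableTypeR R => (x + c : measurableTypeR R)).
  exact: measurable_funD.
move=> mA; apply/esym.
apply: (@lebesgue_measure_unique _ (pushforward mu
  (fun x : measurableTypeR R => (x + c : measurableTypeR R)))) => //= _ [[a b]] _ <-.
rewrite /pushforward/=.
have -> : +%R^~ c @^-1` `]a, b]%classic = `](a - c), (b - c)]%classic :> set R.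
  by apply/seteqP; split => x /=; rewrite !in_itv/= ltrBlDr lerBrDr.
rewrite !lebesgue_measure_itv/= !lte_fin ltrD2r; case: ifP => // _.
by rewrite -!EFinD; congr EFin; ring.
Qed.

(** Phrased with integrals rather than measures of sets, so that it applies directly to the inner
    integral of Fubini. *)
Definition preserving (phi : R -> R) := measurable_fun setT phi /\
  forall f : R -> \bar R, measurable_fun setT f -> (forall x, 0 <= f x)%E ->
  (\int[mu]_x f (phi x) = \int[mu]_x f x)%E.

Lemma preserving_pushforward (phi : measurableTypeR R -> measurableTypeR R) :
  measurable_fun setT phi -> (forall A, measurable A -> pushforward mu phi A = mu A) ->
  preserving phi.
Proof.
move=> mphi pphi; split => // f mf f0.
transitivity (\int[pushforward mu phi]_x f x)%E.
  by rewrite ge0_integral_pushforward.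
by apply: eq_measure_integral => A mA _; exact: pphi.
Qed.

Lemma lebesgue2_fubini1 (f : R * R -> \bar R) :
  measurable_fun setT f -> (forall x, 0 <= f x)%E ->
  (\int[mu2]_x f x = \int[mu]_x \int[mu]_y f (x, y))%E.
Proof. by move=> mf f0; rewrite /lebesgue2 fubini_tonelli1. Qed.

Lemma lebesgue2_fubini2 (f : R * R -> \bar R) :
  measurable_fun setT f -> (forall x, 0 <= f x)%E ->
  (\int[mu2]_x f x = \int[mu]_y \int[mu]_x f (x, y))%E.
Proof. by move=> mf f0; rewrite /lebesgue2 fubini_tonelli2. Qed.

(** Moving each vertical line within itself by a measure-preserving map covers both shears and the
    reflection in an axis. *)
Lemma ge0_integral_snd_preserving (phi : R * R -> R) (f : R * R -> \bar R) :
  measurable_fun setT phi -> (forall x, preserving (fun y => phi (x, y))) ->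
  measurable_fun setT f -> (forall x, 0 <= f x)%E ->
  (\int[mu2]_x f (x.1, phi x) = \int[mu2]_x f x)%E.
Proof.
move=> mphi pphi mf f0.
have ms : measurable_fun setT (fun x : R * R => (x.1, phi x)).
  by apply: measurable_fun_pair.
rewrite [RHS](lebesgue2_fubini1 f)//.
transitivity (\int[mu]_x \int[mu]_y f (x, phi (x, y)))%E.
  exact: (lebesgue2_fubini1 (fun x => f (x.1, phi x)) (measurableT_comp mf ms)).
apply: eq_integral => x _ /=; apply: ((pphi x).2 (fun y => f (x, y))) => //.
by apply: (measurableT_comp mf); exact: measurable_fun_pair.
Qed.

Lemma ge0_integral_fst_preserving (phi : R * R -> R) (f : R * R -> \bar R) :
  measurable_fun setT phi -> (forall y, preserving (fun x => phi (x, y))) ->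
  measurable_fun setT f -> (forall x, 0 <= f x)%E ->
  (\int[mu2]_x f (phi x, x.2) = \int[mu2]_x f x)%E.
Proof.
move=> mphi pphi mf f0.
have ms : measurable_fun setT (fun x : R * R => (phi x, x.2)).
  by apply: measurable_fun_pair.
rewrite [RHS](lebesgue2_fubini2 f)//.
transitivity (\int[mu]_y \int[mu]_x f (phi (x, y), y))%E.
  exact: (lebesgue2_fubini2 (fun x => f (phi x, x.2)) (measurableT_comp mf ms)).
apply: eq_integral => y _ /=; apply: ((pphi y).2 (fun x => f (x, y))) => //.
by apply: (measurableT_comp mf); exact: measurable_fun_pair.
Qed.

Lemma preserving_shift c : preserving (fun x => x + c).
Proof.
apply: preserving_pushforward; last exact: lebesgue_measure_shift.
exact: measurable_funD.
Qed.

Lemma preserving_opp : preserving (fun x => - x).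
Proof.
apply: preserving_pushforward; last exact: lebesgue_measureN.
exact: measurableT_comp.
Qed.

Definition rotation (u x : R * R) : R * R := (u.1 * x.1 - u.2 * x.2, u.2 * x.1 + u.1 * x.2).

Lemma measurable_lin (a b : R) : measurable_fun setT (fun x : R * R => a * x.1 + b * x.2).
Proof. by apply: measurable_funD; apply: measurable_funM. Qed.

Lemma measurable_rotation u : measurable_fun setT (rotation u).
Proof.
rewrite /rotation; apply: measurable_fun_pair; last exact: measurable_lin.
by under eq_fun do rewrite -mulNr; exact: measurable_lin.
Qed.

Lemma ge0_integral_rotation (u : R * R) (f : R * R -> \bar R) :
  u.1 ^+ 2 + u.2 ^+ 2 = 1 -> measurable_fun setT f -> (forall x, 0 <= f x)%E ->
  (\int[mu2]_x f (rotation u x) = \int[mu2]_x f x)%E.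
Proof.
case: u => c s /= cs1 mf f0.
have sh1 a (g : R * R -> \bar R) : measurable_fun setT g -> (forall x, 0 <= g x)%E ->
    (\int[mu2]_x g ((x.1 + a * x.2)%R, x.2) = \int[mu2]_x g x)%E.
  apply: (@ge0_integral_fst_preserving (fun x => x.1 + a * x.2) g); last first.
    by move=> y; exact: (preserving_shift (a * y)).
  by apply: measurable_funD => //; exact: measurable_funM.
have sh2 a (g : R * R -> \bar R) : measurable_fun setT g -> (forall x, 0 <= g x)%E ->
    (\int[mu2]_x g (x.1, (x.2 + a * x.1)%R) = \int[mu2]_x g x)%E.
  apply: (@ge0_integral_snd_preserving (fun x => x.2 + a * x.1) g); last first.
    by move=> y; exact: (preserving_shift (a * y)).
  by apply: measurable_funD => //; exact: measurable_funM.
have ms1 a : measurable_fun setT (fun x : R * R => ((x.1 + a * x.2)%R, x.2)).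
  by apply: measurable_fun_pair => //; apply: measurable_funD => //; exact: measurable_funM.
have ms2 a : measurable_fun setT (fun x : R * R => (x.1, (x.2 + a * x.1)%R)).
  by apply: measurable_fun_pair => //; apply: measurable_funD => //; exact: measurable_funM.
(* The shear parameter (c - 1) / s requires s to be nonzero. When s = 0 the rotation is the identity
   or minus the identity, the latter a product of two reflections. *)
have [s0|s0] := eqVneq s 0.
  have : (c - 1) * (c + 1) = 0 by rewrite s0 in cs1; lra.
  move/eqP; rewrite mulf_eq0 subr_eq0 addr_eq0 => /orP[]/eqP ->.
    by apply: eq_integral => -[x y] _; rewrite /rotation s0/= !mul1r !mul0r subr0 add0r.
  transitivity (\int[mu2]_x f (x.1, - x.2)%R)%E; last first.
    apply: (@ge0_integral_snd_preserving (fun x => - x.2)) => //; last first.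
      by move=> x; exact: preserving_opp.
    exact: measurableT_comp.
  rewrite -(@ge0_integral_fst_preserving (fun x => - x.1) (fun x => f (x.1, - x.2)))//.
  - by apply: eq_integral => -[x y] _; rewrite /rotation s0/= !mulN1r !mul0r subr0 add0r.
  - exact: measurableT_comp.
  - by move=> x; exact: preserving_opp.
  - apply: (measurableT_comp mf); apply: measurable_fun_pair => //.
    exact: measurableT_comp.
(* A rotation of angle t is a product of three shears: with a = - tan (t / 2),
   (x, y) -> (x + a y, y), then (x, y) -> (x, y + s x), then the first again. *)
pose a := (c - 1) / s.
pose g (x : R * R) := f (x.1 + a * x.2, x.2).
pose h (x : R * R) := g (x.1, x.2 + s * x.1).
have mg : measurable_fun setT g by exact: (measurableT_comp mf (ms1 a)).
have mh : measurable_fun setT h by exact: (measurableT_comp mg (ms2 s)).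
have g0 x : (0 <= g x)%E by exact: f0.
have h0 x : (0 <= h x)%E by exact: f0.
rewrite -(sh1 a f)// -/(g _) -(sh2 s g)// -/(h _) -(sh1 a h)//.
apply: eq_integral => -[x y] _; rewrite /h /g /rotation/=; congr (f (_, _)).
  rewrite /a; have -> : c * x - s * y = c * x + (c ^+ 2 - 1) / s * y.
    by rewrite -cs1; field.
  by field.
by rewrite /a; field.
Qed.

Definition preserving2 (T : R * R -> R * R) := measurable_fun setT T /\
  forall f : R * R -> \bar R, measurable_fun setT f -> (forall x, 0 <= f x)%E ->
  (\int[mu2]_x f (T x) = \int[mu2]_x f x)%E.

Lemma preserving2_rotation u : u.1 ^+ 2 + u.2 ^+ 2 = 1 -> preserving2 (rotation u).
Proof.
move=> u1; split; first exact: measurable_rotation.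
by move=> f; exact: ge0_integral_rotation.
Qed.

Lemma preserving2_conj : preserving2 (fun x => (x.1, - x.2)).
Proof.
split.
  by apply: measurable_fun_pair => //; exact: measurableT_comp.
move=> f; apply: (@ge0_integral_snd_preserving (fun x => - x.2)) => //; last first.
      by move=> x; exact: preserving_opp.
exact: measurableT_comp.
Qed.

Lemma integral_preserving2 T (f : R * R -> \bar R) : preserving2 T ->
  measurable_fun setT f -> (\int[mu2]_x f (T x) = \int[mu2]_x f x)%E.
Proof.
move=> [mT pT] mf; rewrite integralE [RHS]integralE.
congr (_ - _)%E.
- transitivity (\int[mu2]_x (f^\+ (T x)))%E.
    by apply: eq_integral => x _; rewrite !(funeposE, funenegE).
  by apply: pT => //; exact: measurable_funepos.
- transitivity (\int[mu2]_x (f^\- (T x)))%E.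
    by apply: eq_integral => x _; rewrite !(funeposE, funenegE).
  by apply: pT => //; exact: measurable_funeneg.
Qed.

Lemma Rintegral_preserving2 T A (f : R * R -> R) : preserving2 T ->
  measurable A -> measurable_fun setT f ->
  \int[mu2]_(x in T @^-1` A) f (T x) = \int[mu2]_(x in A) f x.
Proof.
move=> pT mA mf; rewrite Rintegral_mkcond [RHS]Rintegral_mkcond; congr fine.
rewrite -(@integral_preserving2 T (fun x => ((f \_ A) x)%:E))//.
apply/measurable_EFinP; apply/(measurable_restrictT _ mA); exact: measurable_funTS.
Qed.

End invariance.

(** * Moments of the disc and of a sector *)

Section moments.
Context {R : realType}.
Local Notation mu := (@lebesgue_measure R).
Local Notation mu2 := (@lebesgue2 R).
Local Notation D := (@unit_disc R).
(* The domain of lebesgue2: as a measurable type it differs from R * R by its display only,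
   but the two are not unifiable. *)
Local Notation R2 := (measurableTypeR R * measurableTypeR R)%type.
Implicit Types A B : set R2.

Lemma measurable_le_fun (f g : R * R -> R) : measurable_fun setT f -> measurable_fun setT g ->
  measurable [set x | f x <= g x].
Proof.
move=> mf mg.
have -> : [set x | f x <= g x] = setT `&` (fun x => f x - g x) @^-1` `]-oo, 0].
  by rewrite setTI; apply/seteqP; split => x /=; rewrite in_itv/= subr_le0.
by have := measurable_funB mf mg; apply.
Qed.

Lemma measurable_enorm : measurable_fun setT (@enorm R).
Proof.
apply: (@measurableT_comp _ _ _ _ _ _ (@Num.sqrt R)).
  apply: continuous_measurable_fun; exact: sqrt_continuous.
by apply: measurable_funD; exact: measurable_funX.
Qed.

Lemma measurable_wedge (u : R * R) : measurable (wedge u).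
Proof.
have -> : wedge u = D `&` [set x | enorm x <= 2 * dotp x u] by [].
apply: measurableI; first exact: measurable_unit_disc.
apply: measurable_le_fun; first exact: measurable_enorm.
by apply: measurable_funM => //; apply: measurable_funD; exact: measurable_funM.
Qed.

Lemma le_disc_lty A : measurable A -> A `<=` D -> (mu2 A < +oo)%E.
Proof.
move=> mA AD; apply: (@le_lt_trans _ _ (mu2 D)).
  by apply: le_measure => //; rewrite inE//; exact: measurable_unit_disc.
by rewrite lebesgue2_unit_disc ltry.
Qed.

Lemma integrable_disc A (f : R * R -> R) (C : R) : measurable A -> A `<=` D ->
  measurable_fun setT f -> (forall x, D x -> `|f x| <= C) -> mu2.-integrable A (EFin \o f).
Proof.
move=> mA AD mf fC; apply: measurable_bounded_integrable => //.
- exact: le_disc_lty.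
- exact: measurable_funTS.
- exists C; split; first exact: num_real.
  by move=> M CM x Ax; apply: (le_trans (fC x (AD _ Ax))); exact: ltW.
Qed.

Lemma disc_coord (x : R * R) : D x -> `|x.1| <= 1 /\ `|x.2| <= 1.
Proof.
by rewrite /unit_disc/= !ler_norml => h; split; apply/andP; split; nra.
Qed.

Lemma integrable_fst A : measurable A -> A `<=` D ->
  mu2.-integrable A (EFin \o (fun x : R * R => x.1)).
Proof.
move=> mA AD; apply: (@integrable_disc _ _ 1) => // [|x /(disc_coord x)[]//].
exact: measurable_fst.
Qed.

Lemma integrable_snd A : measurable A -> A `<=` D ->
  mu2.-integrable A (EFin \o (fun x : R * R => x.2)).
Proof.
move=> mA AD; apply: (@integrable_disc _ _ 1) => // [|x /(disc_coord x)[]//].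
exact: measurable_snd.
Qed.

Lemma integrable_sqnorm A : measurable A -> A `<=` D ->
  mu2.-integrable A (EFin \o (fun x : R * R => x.1 ^+ 2 + x.2 ^+ 2)).
Proof.
move=> mA AD; apply: (@integrable_disc _ _ 1) => //.
  by apply: measurable_funD; exact: measurable_funX.
by move=> x Dx; rewrite ger0_norm// addr_ge0// sqr_ge0.
Qed.

Lemma integrable_one A (c : R) : measurable A -> A `<=` D ->
  mu2.-integrable A (EFin \o (fun x : R * R => c)).
Proof. by move=> mA AD; apply: (@integrable_disc _ _ `|c|). Qed.

Lemma Rintegral_sqdist A (a : R * R) : measurable A -> A `<=` D ->
  \int[mu2]_(x in A) enorm (x - a) ^+ 2 =
  \int[mu2]_(x in A) (x.1 ^+ 2 + x.2 ^+ 2)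
  - 2 * a.1 * \int[mu2]_(x in A) x.1 - 2 * a.2 * \int[mu2]_(x in A) x.2
  + (a.1 ^+ 2 + a.2 ^+ 2) * \int[mu2]_(x in A) 1.
Proof.
move=> mA AD.
have i1 := integrable_fst A mA AD; have i2 := integrable_snd A mA AD.
have iN := integrable_sqnorm A mA AD; have i0 c := integrable_one A c mA AD.
have z1 : mu2.-integrable A (EFin \o (fun x : R * R => 2 * a.1 * x.1)).
  exact: (integrableZl mA (2 * a.1) i1).
have z2 : mu2.-integrable A (EFin \o (fun x : R * R => 2 * a.2 * x.2)).
  exact: (integrableZl mA (2 * a.2) i2).
have z0 : mu2.-integrable A (EFin \o (fun x : R * R => (a.1 ^+ 2 + a.2 ^+ 2) * 1)).
  exact: i0.
have zN1 : mu2.-integrable A (EFin \o (fun x : R * R => x.1 ^+ 2 + x.2 ^+ 2 - 2 * a.1 * x.1)).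
  exact: (integrableB mA iN z1).
have zN2 : mu2.-integrable A (EFin \o (fun x : R * R =>
    x.1 ^+ 2 + x.2 ^+ 2 - 2 * a.1 * x.1 - 2 * a.2 * x.2)).
  exact: (integrableB mA zN1 z2).
rewrite -!RintegralZl// -RintegralB// -RintegralB// -RintegralD//.
by apply: eq_Rintegral => x _; rewrite sqr_sqrtr ?addr_ge0 ?sqr_ge0//=; ring.
Qed.

(** Closed cells share boundary rays, so additivity is needed up to a null overlap; the overlap is
    removed from B. *)
Lemma Rintegral_setU_null A B (f : R * R -> R) : measurable A -> measurable B ->
  mu2.-integrable (A `|` B) (EFin \o f) -> mu2 (A `&` B) = 0%E ->
  \int[mu2]_(x in A `|` B) f x = \int[mu2]_(x in A) f x + \int[mu2]_(x in B) f x.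
Proof.
move=> mA mB fi AB0.
have fB : mu2.-integrable B (EFin \o f) by apply: integrableS fi => //; exact: measurableU.
have -> : A `|` B = A `|` (B `\` A).
  apply/seteqP; split => x; last by move=> [Ax|[Bx _]]; [left|right].
  by have [Ax|nAx] := pselect (A x); [left|move=> [//|Bx]; right].
have mBA : measurable (B `\` A) by exact: measurableD.
rewrite Rintegral_setU//; last 2 first.
- apply: integrableS fi; [exact: measurableU|exact: measurableU|].
  by move=> x [|[]]; [left|right].
- by apply/disj_setPS => x [? []].
congr (_ + _).
rewrite {2}/Rintegral (negligible_integral _ mB fB AB0); last exact: measurableI.
by congr fine; congr (integral _ _ _); rewrite setDIr setDv setU0.
Qed.

Lemma integral_itv_is_derive (f F : R -> R) (a b : R) : a <= b ->
  (forall t, is_derive t (1 : R) F (f t)) -> continuous f ->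
  (\int[mu]_(x in `[a, b]) (f x)%:E = (F b - F a)%:E)%E.
Proof.
(* Sections at extreme heights shrink to a point, whereas the fundamental theorem is applied for a <
   b. *)
rewrite le_eqVlt => /predU1P[<- _ _|ab dF cf].
  by rewrite subrr set_itv1 integral_set1.
have cF : continuous F.
  move=> t; apply/differentiable_continuous/derivable1_diffP.
  exact: (@ex_derive _ _ _ _ _ _ _ (dF t)).
rewrite (@continuous_FTC2 _ f F)//.
- exact: continuous_subspaceT.
- split => [x _||].
  + exact: (@ex_derive _ _ _ _ _ _ _ (dF x)).
  + by apply: cvg_at_right_filter; exact: cF.
  + by apply: cvg_at_left_filter; exact: cF.
- by move=> t _; rewrite derive1E (@derive_val _ _ _ _ _ _ _ (dF t)).
Qed.

(* By the symmetry x.2 -> - x.2. *)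
Lemma wedge_moment_snd : \int[mu2]_(x in wedge (1, 0)) x.2 = 0.
Proof.
have mW := measurable_wedge (1, 0).
have := @Rintegral_preserving2 _ _ (wedge (1, 0)) (fun x => x.2) preserving2_conj mW measurable_snd.
have -> : (fun x : R * R => (x.1, - x.2)) @^-1` wedge (1, 0) = wedge (1, 0).
  by apply/seteqP; split=> -[x y]; rewrite /wedge /= /enorm /dotp/= sqrrN !mulr0 !mulr1.
rewrite /=; under eq_Rintegral do rewrite -mulN1r.
rewrite RintegralZl//; first lra.
by apply: integrable_snd => // x [].
Qed.

(** A horizontal section runs from the boundary ray x = |y| / sqrt 3 to the circle; the two meet at
    |y| = sqrt 3 / 2. Vertical sections would change formula at x = 1/2. *)
Lemma wedge_section (y : R) :
  [set x | wedge (1, 0) (x, y)] = (if 4 * y ^+ 2 <= 3 then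
    `[`|y| / Num.sqrt 3, Num.sqrt (1 - y ^+ 2)]%classic else set0).
Proof.
have s3 : 0 < Num.sqrt 3 :> R by rewrite sqrtr_gt0.
have s32 : Num.sqrt 3 ^+ 2 = 3 :> R by rewrite sqr_sqrtr.
apply/seteqP; split => x /=.
  rewrite /wedge /dotp /enorm/= mulr0 addr0 mulr1 => -[xy1 xyx].
  have x0 : 0 <= x by have := sqrtr_ge0 (x ^+ 2 + y ^+ 2); lra.
  have : x ^+ 2 + y ^+ 2 <= (2 * x) ^+ 2.
    by rewrite -[leLHS]sqr_sqrtr ?addr_ge0 ?sqr_ge0// ler_sqr ?nnegrE ?mulr_ge0 ?sqrtr_ge0.
  move=> xy; case: ifPn => [_|]; last by move=> /negP; apply; lra.
  rewrite /= in_itv/= ler_pdivrMr//; apply/andP; split.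
    have -> : x * Num.sqrt 3 = Num.sqrt (x ^+ 2 * 3).
      by rewrite sqrtrM ?sqr_ge0// sqrtr_sqr ger0_norm.
    by rewrite -sqrtr_sqr ler_wsqrtr//; lra.
  by rewrite -[x](ger0_norm x0) -sqrtr_sqr ler_wsqrtr//; lra.
case: ifPn => // y3 /=; rewrite in_itv/= => /andP[x1 x2].
have x0 : 0 <= x by apply: le_trans x1; rewrite divr_ge0// ltW.
rewrite ler_pdivrMr// in x1.
have x1' : y ^+ 2 <= 3 * x ^+ 2.
  rewrite -[y ^+ 2]real_normK ?num_real//.
  have -> : 3 * x ^+ 2 = (x * Num.sqrt 3) ^+ 2 by rewrite exprMn s32 mulrC.
  by rewrite ler_sqr ?nnegrE// mulr_ge0// ltW.
have x2' : x ^+ 2 <= 1 - y ^+ 2.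
  rewrite -[leRHS]sqr_sqrtr; last by lra.
  by rewrite ler_sqr ?nnegrE ?sqrtr_ge0.
rewrite /wedge /dotp /enorm/= mulr0 addr0 mulr1; split; first lra.
have -> : 2 * x = Num.sqrt ((2 * x) ^+ 2) by rewrite sqrtr_sqr ger0_norm// mulr_ge0.
by rewrite ler_wsqrtr//; lra.
Qed.

Lemma integral_section1 A (f : R -> R) : measurable A -> measurable_fun setT f ->
  (forall x, A x -> 0 <= f x.1) ->
  (\int[mu2]_(x in A) (f x.1)%:E = \int[mu]_y \int[mu]_(x in [set x | A (x, y)]) (f x)%:E)%E.
Proof.
move=> mA mf f0.
have mf1 : measurable_fun setT (fun x : R * R => (f x.1)%:E).
  by apply/measurable_EFinP; apply: (measurableT_comp mf); exact: measurable_fst.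
rewrite integral_mkcond lebesgue2_fubini2.
- by apply: eq_integral => y _; rewrite [RHS]integral_mkcond; apply: eq_integral => x _;
    rewrite !patchE; congr (if _ then _ else _); rewrite !in_setE.
- by apply/(measurable_restrictT _ mA); exact: measurable_funTS.
- by move=> x; apply: erestrict_ge0 => z Az; rewrite lee_fin f0.
Qed.

Lemma integral_section2 A (f : R -> R) : measurable A -> measurable_fun setT f ->
  (forall x, A x -> 0 <= f x.1) ->
  (\int[mu2]_(x in A) (f x.1)%:E = \int[mu]_x \int[mu]_(y in [set y | A (x, y)]) (f x)%:E)%E.
Proof.
move=> mA mf f0.
have mf1 : measurable_fun setT (fun x : R * R => (f x.1)%:E).
  by apply/measurable_EFinP; apply: (measurableT_comp mf); exact: measurable_fst.
rewrite integral_mkcond lebesgue2_fubini1.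
- by apply: eq_integral => y _; rewrite [RHS]integral_mkcond; apply: eq_integral => x _;
    rewrite !patchE; congr (if _ then _ else _); rewrite !in_setE.
- by apply/(measurable_restrictT _ mA); exact: measurable_funTS.
- by move=> x; apply: erestrict_ge0 => z Az; rewrite lee_fin f0.
Qed.

Lemma wedge_moment_fst : \int[mu2]_(x in wedge (1, 0)) x.1 = Num.sqrt 3 / 3.
Proof.
have mW := measurable_wedge (1 : R, 0 : R).
have s3 : 0 < Num.sqrt 3 :> R by rewrite sqrtr_gt0.
have s32 : Num.sqrt 3 ^+ 2 = 3 :> R by rewrite sqr_sqrtr.
have W0 x : wedge (1, 0) x -> (0 : R) <= x.1.
  case=> _; rewrite /dotp/= mulr1 mulr0 addr0.
  by have := sqrtr_ge0 (x.1 ^+ 2 + x.2 ^+ 2); rewrite -/(enorm x); lra.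
rewrite /Rintegral (integral_section1 _ id)//.
(* The inner integral of x is half the difference of the squared ends: ((1 - y^2) - y^2 / 3) / 2. *)
transitivity (fine
  (\int[mu]_(y in `[(- (Num.sqrt 3 / 2))%R, (Num.sqrt 3 / 2)%R]) (2^-1 - 2 / 3 * y ^+ 2)%:E)%E).
  congr fine; rewrite [RHS]integral_mkcond; apply: eq_integral => y _.
  rewrite wedge_section patchE.
  have -> : (y \in `[(- (Num.sqrt 3 / 2))%R, (Num.sqrt 3 / 2)%R]%classic) = (4 * y ^+ 2 <= 3).
    apply/idP/idP; rewrite inE/= in_itv/=.
      by move=> /andP[? ?]; nra.
    move=> y3; rewrite -ler_norml ler_pdivlMr//.
    have -> : `|y| * 2 = Num.sqrt ((y * 2) ^+ 2) by rewrite sqrtr_sqr normrM (@ger0_norm _ 2).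
    by rewrite ler_wsqrtr//; lra.
  case: ifPn => [y3|_]; last by rewrite integral_set0.
  have xle : `|y| / Num.sqrt 3 <= Num.sqrt (1 - y ^+ 2).
    by rewrite -sqrtr_sqr -sqrtrV// -sqrtrM ?sqr_ge0// ler_wsqrtr//; lra.
  have dF (t : R) : is_derive t (1 : R) (fun x => x ^+ 2 / 2) t.
    by apply: is_derive_eq; rewrite /GRing.scale/=; lra.
  rewrite (integral_itv_is_derive _ _ _ _ xle dF)//; last by move=> t; exact: cvg_id.
  rewrite sqr_sqrtr; last by lra.
  by rewrite expr_div_n s32 real_normK ?num_real//; congr EFin; lra.
have dG (t : R) : is_derive t (1 : R) (fun y => y / 2 - 2 / 9 * y ^+ 3) (2^-1 - 2 / 3 * t ^+ 2).
  by apply: is_derive_eq; rewrite /GRing.scale/=; lra.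
apply: (@congr1 _ _ fine _ (Num.sqrt 3 / 3)%:E).
apply: etrans; first apply: (integral_itv_is_derive _ _ _ _ _ dG).
- lra.
- move=> t; apply: cvgB; first exact: cvg_cst.
  by apply: cvgM; [exact: cvg_cst|exact: exprn_continuous].
- have e3 : (Num.sqrt 3 / 2) ^+ 3 = Num.sqrt 3 * 3 / 8 :> R.
    by rewrite expr_div_n exprS s32; field.
  by congr EFin; rewrite exprNn e3; field.
Qed.

Lemma disc_section (x : R) :
  [set y | D (x, y)] = (if x ^+ 2 <= 1 then
    `[- Num.sqrt (1 - x ^+ 2), Num.sqrt (1 - x ^+ 2)]%classic else set0).
Proof.
apply/seteqP; split => y /=.
  rewrite /unit_disc/= => xy.
  case: ifPn => [x1|]; last by move=> /negP; apply; have := sqr_ge0 y; lra.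
  by rewrite /= in_itv/= -ler_norml -sqrtr_sqr ler_wsqrtr//; lra.
case: ifPn => //= x1; rewrite in_itv/= -ler_norml -sqrtr_sqr ler_sqrt ?subr_ge0// /unit_disc/=.
by lra.
Qed.

Lemma disc_moment_fst2 : \int[mu2]_(x in D) x.1 ^+ 2 = pi / 4.
Proof.
have mD := @measurable_unit_disc R.
have mf : measurable_fun setT (fun x : R => x ^+ 2).
  by apply: continuous_measurable_fun; exact: exprn_continuous.
rewrite /Rintegral (integral_section2 _ (fun x => x ^+ 2) mD mf); last first.
  by move=> x _; exact: sqr_ge0.
(* The vertical chord at x has length 2 sqrt (1 - x^2). The substitution x = sin t follows. *)
transitivity (fine (\int[mu]_(x in `[(-1)%R, 1%R]) (x ^+ 2 * (2 * Num.sqrt (1 - x ^+ 2)))%:E)%E).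
  congr fine; rewrite [RHS]integral_mkcond; apply: eq_integral => x _.
  rewrite disc_section patchE.
  have -> : (x \in `[(-1)%R, 1%R]%classic) = (x ^+ 2 <= 1).
    apply/idP/idP; rewrite inE/= in_itv/= -ler_norml -[x ^+ 2]real_normK ?num_real// expr_le1//.
  case: ifPn => [x1|_]; last by rewrite integral_set0.
  have c0 := sqrtr_ge0 (1 - x ^+ 2).
  have dF (t : R) : is_derive t (1 : R) (fun y => x ^+ 2 * y) (x ^+ 2).
    by apply: is_derive_eq; rewrite /GRing.scale/=; lra.
  apply: etrans; first apply: (integral_itv_is_derive _ _ _ _ _ dF).
  - lra.
  - by move=> t; exact: cvg_cst.
  - by congr EFin; ring.
have Npp : - (pi / 2) < pi / 2 :> R by rewrite gtrN// divr_gt0// pi_gt0.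
have dsin : derive1 (@sin R) = cos by apply/funext => x; rewrite derive1E derive_val.
have -> : `[(-1 : R), 1]%classic = `[sin (- (pi / 2)), sin (pi / 2)]%classic.
  by rewrite sinN sin_pihalf.
rewrite (@integration_by_substitution_increasing R (@sin R)
    (fun x => x ^+ 2 * (2 * Num.sqrt (1 - x ^+ 2)))) //; last 7 first.
- by apply: ltW.
- by move=> x y xI yI xy; rewrite ltr_sin.
- by move=> x _; rewrite dsin; exact: continuous_cos.
- by rewrite dsin; apply/cvg_ex; exists (cos (- (pi / 2)));
    apply: cvg_at_right_filter; exact: continuous_cos.
- by rewrite dsin; apply/cvg_ex; exists (cos (pi / 2));
    apply: cvg_at_left_filter; exact: continuous_cos.
- split; first by move=> x _; exact: ex_derive.
  + by apply: cvg_at_right_filter; exact: continuous_sin.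
  + by apply: cvg_at_left_filter; exact: continuous_sin.
- apply: continuous_subspaceT => x.
  apply: cvgM; first exact: exprn_continuous.
  apply: cvgM; first exact: cvg_cst.
  apply: (@continuous_comp _ _ _ (fun x : R => 1 - x ^+ 2)); last exact: sqrt_continuous.
  by apply: cvgB; [exact: cvg_cst|exact: exprn_continuous].
transitivity (fine
  (\int[mu]_(t in `[(- (pi / 2))%R, (pi / 2)%R]) (2 * (sin t ^+ 2 * cos t ^+ 2))%:E)%E).
  congr fine; apply: eq_integral => t; rewrite inE/= in_itv/= => tI.
  rewrite -[LHS]/((sin t ^+ 2 * (2 * Num.sqrt (1 - sin t ^+ 2)) * derive1 (@sin R) t)%:E).
  rewrite dsin -cos2sin2 sqrtr_sqr ger0_norm ?cos_ge0_pihalf//.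
  by congr EFin; ring.
(* The integrand equals (1 - cos (4 t)) / 4; the antiderivative is (t - sin (4 t) / 4) / 4 with sin
   (4 t) expanded. *)
have dF (t : R) : is_derive t (1 : R) (fun t => (t - sin t * cos t * (1 - 2 * sin t ^+ 2)) / 4)
    (2 * (sin t ^+ 2 * cos t ^+ 2)).
  apply: is_derive_eq; rewrite /GRing.scale/=.
  have c2 : cos t ^+ 2 = 1 - sin t ^+ 2 := cos2sin2 t.
  transitivity ((1 + 4 * sin t ^+ 2 * cos t ^+ 2
      - (1 - 2 * sin t ^+ 2) * (cos t ^+ 2 - sin t ^+ 2)) / 4); first by field.
  by rewrite c2; field.
apply: (@congr1 _ _ fine _ (pi / 4)%:E).
apply: etrans; first apply: (integral_itv_is_derive _ _ _ _ _ dF).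
- exact: ltW.
- move=> t; apply: cvgM; first exact: cvg_cst.
  by apply: cvgM; rewrite expr2; apply: cvgM; (exact: continuous_sin || exact: continuous_cos).
- by congr EFin; rewrite cosN cos_pihalf; field.
Qed.

(** A quarter turn exchanges the two coordinate second moments, and a half turn changes the sign of
    the first moments. *)
Lemma disc_moments : [/\ \int[mu2]_(x in D) (x.1 ^+ 2 + x.2 ^+ 2) = pi / 2,
  \int[mu2]_(x in D) x.1 = 0, \int[mu2]_(x in D) x.2 = 0 &
  \int[mu2]_(x in D) 1 = pi].
Proof.
have mD := @measurable_unit_disc R.
have rotD (u : R * R) : u.1 ^+ 2 + u.2 ^+ 2 = 1 -> rotation u @^-1` D = D.
  move=> u1; apply/seteqP; rewrite /rotation/unit_disc; split => -[x y] /=.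
    have -> : (u.1 * x - u.2 * y) ^+ 2 + (u.2 * x + u.1 * y) ^+ 2 =
      (u.1 ^+ 2 + u.2 ^+ 2) * (x ^+ 2 + y ^+ 2) by ring.
    by rewrite u1 mul1r.
  have -> : (u.1 * x - u.2 * y) ^+ 2 + (u.2 * x + u.1 * y) ^+ 2 =
    (u.1 ^+ 2 + u.2 ^+ 2) * (x ^+ 2 + y ^+ 2) by ring.
  by rewrite u1 mul1r.
have N1 : (-1 : R, 0 : R).1 ^+ 2 + (-1 : R, 0 : R).2 ^+ 2 = 1.
  by rewrite /= sqrrN expr1n expr0n addr0.
have i1 : (0 : R, 1 : R).1 ^+ 2 + (0 : R, 1 : R).2 ^+ 2 = 1 by rewrite /= expr1n expr0n add0r.
have ifst := integrable_fst D mD (@subset_refl _ D).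
have isnd := integrable_snd D mD (@subset_refl _ D).
have rI (u : R * R) (f : R * R -> R) (u1 : u.1 ^+ 2 + u.2 ^+ 2 = 1) (mf : measurable_fun setT f) :
    \int[mu2]_(x in D) f (rotation u x) = \int[mu2]_(x in D) f x.
  by rewrite -[RHS](@Rintegral_preserving2 _ _ D f (preserving2_rotation u u1) mD mf) rotD.
have isq1 : mu2.-integrable D (EFin \o (fun x : R * R => x.1 ^+ 2)).
  apply: (integrable_disc D _ 1) => // [|x /(disc_coord x)[x1 _]].
    by apply: measurable_funX; exact: measurable_fst.
  by rewrite normrX expr_le1.
have isq2 : mu2.-integrable D (EFin \o (fun x : R * R => x.2 ^+ 2)).
  apply: (integrable_disc D _ 1) => // [|x /(disc_coord x)[_ x2]].
    by apply: measurable_funX; exact: measurable_snd.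
  by rewrite normrX expr_le1.
split.
- rewrite RintegralD//.
  rewrite -(rI (0, 1) (fun x => x.2 ^+ 2))//; last first.
    by apply: measurable_funX; exact: measurable_snd.
  under [X in _ + X]eq_Rintegral do rewrite /= mul1r mul0r addr0.
  by rewrite disc_moment_fst2; lra.
- have := rI (-1, 0) (fun x => x.1) N1 measurable_fst.
  under eq_Rintegral do rewrite /= mul0r subr0.
  by rewrite RintegralZl//; lra.
- have := rI (-1, 0) (fun x => x.2) N1 measurable_snd.
  under eq_Rintegral do rewrite /= mul0r add0r.
  by rewrite RintegralZl//; lra.
- by rewrite Rintegral_cst// [X in fine X]lebesgue2_unit_disc mul1r.
Qed.

End moments.

(** * Distortion *)

Section distortion.
Context {R : realType}.
Local Notation mu2 := (@lebesgue2 R).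
Local Notation D := (@unit_disc R).
Local Notation R2 := (measurableTypeR R * measurableTypeR R)%type.

Lemma uniform_discE (A : set (R * R)) : measurable A -> A `<=` D ->
  uniform_disc A = ((pi^-1)%:E * mu2 A)%E.
Proof.
move=> mA AD; rewrite /uniform_disc.
transitivity (\int[mu2]_(x in A) (cst (pi^-1)%:E x))%E.
  apply: eq_integral => x; rewrite inE => /AD Dx.
  by rewrite /disc_pdf indicE mem_set// mulr1.
exact: integral_cst.
Qed.

Lemma integral_uniform_disc (f : R * R -> \bar R) :
  measurable_fun setT f -> (forall x, 0 <= f x)%E ->
  (\int[@uniform_disc R]_x f x = (pi^-1)%:E * \int[mu2]_(x in D) f x)%E.
Proof.
move=> mf f0.
have mD := @measurable_unit_disc R.
have pi0 : 0 <= (pi : R)^-1 by rewrite invr_ge0 pi_ge0.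
have nD : uniform_disc (~` D) = 0%E.
  rewrite /uniform_disc -[RHS](@integral0 _ _ _ mu2 (~` D)); apply: eq_integral => x.
  by rewrite inE => nDx; rewrite /disc_pdf indicE memNset// mulr0.
rewrite (@ge0_negligible_integral _ _ _ _ setT (~` D))//; last exact: measurableC.
rewrite setTD setCK.
pose m := mscale (NngNum pi0) mu2.
(* The identity, used only to carry the measure from one display of the plane to the other. *)
pose phi : R2 -> (R * R)%type := id.
have mphi : measurable_fun setT phi by move=> _ A mA; rewrite setTI.
transitivity (\int[pushforward m phi]_(x in D) f x)%E.
  apply: eq_measure_integral => A mA AD.
  exact: (uniform_discE A mA AD).
rewrite ge0_integral_pushforward//; last exact: measurable_funTS.
rewrite ge0_integral_mscale//.
exact: measurable_funTS.
Qed.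

Definition mindist2 (alpha : {fset R * R}) (x : R * R) : \bar R :=
  \big[Order.min/+oo%E]_(a <- alpha) (enorm (x - a) ^+ 2)%:E.

Lemma mindist2_le alpha a x : a \in alpha -> (mindist2 alpha x <= (enorm (x - a) ^+ 2)%:E)%E.
Proof. by move=> aa; rewrite /mindist2; apply: bigmin_inf_seq aa _ _. Qed.

Lemma le_mindist2 alpha x (c : \bar R) :
  (forall a, a \in alpha -> c <= (enorm (x - a) ^+ 2)%:E)%E -> (c <= mindist2 alpha x)%E.
Proof. by move=> h; rewrite /mindist2 big_seq; apply: le_bigmin => //; rewrite leey. Qed.

Lemma measurable_mindist2 alpha : measurable_fun setT (mindist2 alpha).
Proof.
rewrite /mindist2; elim: (enum_fset alpha) => [|a s IH].
  by under eq_fun do rewrite big_nil; exact: measurable_cst.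
under eq_fun do rewrite big_cons.
apply: measurable_mine => //; apply/measurable_EFinP.
apply: measurable_funX; apply: (measurableT_comp measurable_enorm).
by apply: measurable_fun_pair; apply: measurable_funB.
Qed.

Lemma mindist2_ge0 alpha x : (0 <= mindist2 alpha x)%E.
Proof. by apply: le_mindist2 => a _; rewrite lee_fin sqr_ge0. Qed.

Lemma distortionE alpha : distortion (@uniform_disc R) alpha =
  ((pi^-1)%:E * \int[mu2]_(x in D) mindist2 alpha x)%E.
Proof.
apply: integral_uniform_disc; first exact: measurable_mindist2.
exact: mindist2_ge0.
Qed.

Lemma voronoi_mindist2 alpha a x : a \in alpha -> voronoi alpha a x ->
  mindist2 alpha x = (enorm (x - a) ^+ 2)%:E.
Proof.
rewrite /voronoi/= => aa vx; apply/eqP; rewrite eq_le mindist2_le//=.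
apply: le_mindist2 => b ba; rewrite lee_fin ler_sqr ?nnegrE ?sqrtr_ge0//.
by rewrite -lee_fin vx; apply: bigmin_inf_seq ba _ _.
Qed.

Lemma wedge_disc (u : R * R) : wedge u `<=` D.
Proof. by move=> x []. Qed.

(** Rotating back to the wedge of axis (1, 0) leaves a single shape to integrate over. Its area and
    second moment stay symbolic until a partition of D determines them. *)
Lemma Rintegral_wedge_sqdist (u a : R * R) : u.1 ^+ 2 + u.2 ^+ 2 = 1 ->
  \int[mu2]_(x in wedge u) enorm (x - a) ^+ 2 =
  \int[mu2]_(x in wedge (1, 0)) (x.1 ^+ 2 + x.2 ^+ 2)
  - 2 * (Num.sqrt 3 / 3) * dotp a u
  + (a.1 ^+ 2 + a.2 ^+ 2) * \int[mu2]_(x in wedge (1, 0)) 1.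
Proof.
move=> u1; have mW := @measurable_wedge R.
have msq : measurable_fun setT (fun x : R * R => enorm (x - a) ^+ 2).
  apply: measurable_funX; apply: (measurableT_comp measurable_enorm).
  by apply: measurable_fun_pair; apply: measurable_funB.
rewrite -(@Rintegral_preserving2 _ _ (wedge u) _ (preserving2_rotation u u1) (mW u) msq).
have sqE (x y : R) : (u.1 * x - u.2 * y) ^+ 2 + (u.2 * x + u.1 * y) ^+ 2 = x ^+ 2 + y ^+ 2.
  transitivity ((u.1 ^+ 2 + u.2 ^+ 2) * (x ^+ 2 + y ^+ 2)); first ring.
  by rewrite u1 mul1r.
have -> : rotation u @^-1` wedge u = wedge (1, 0).
  have dE (x y : R) : (u.1 * x - u.2 * y) * u.1 + (u.2 * x + u.1 * y) * u.2 = x.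
    by rewrite -[RHS]mulr1 -u1; ring.
  by apply/seteqP; split => -[x y]; rewrite /wedge/rotation/dotp/enorm/= sqE dE mulr1 mulr0 addr0.
(* [b] is [a] turned back: in complex notation, a times the conjugate of u. *)
pose b : R * R := (a.1 * u.1 + a.2 * u.2, a.2 * u.1 - a.1 * u.2).
transitivity (\int[mu2]_(x in wedge (1, 0)) enorm (x - b) ^+ 2).
  apply: eq_Rintegral => -[x y] _; rewrite /enorm/rotation/= !sqr_sqrtr ?addr_ge0 ?sqr_ge0//.
  rewrite -[RHS]sqE /b/=; congr (_ ^+ 2 + _ ^+ 2).
    transitivity (u.1 * x - u.2 * y - a.1 * (u.1 ^+ 2 + u.2 ^+ 2)); last by ring.
    by rewrite u1 mulr1.
  transitivity (u.2 * x + u.1 * y - a.2 * (u.1 ^+ 2 + u.2 ^+ 2)); last by ring.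
  by rewrite u1 mulr1.
rewrite (Rintegral_sqdist _ _ (mW _) (wedge_disc _)).
rewrite wedge_moment_fst wedge_moment_snd /b /dotp/=.
have -> : (a.1 * u.1 + a.2 * u.2) ^+ 2 + (a.2 * u.1 - a.1 * u.2) ^+ 2 =
   (a.1 ^+ 2 + a.2 ^+ 2) * (u.1 ^+ 2 + u.2 ^+ 2) by ring.
by rewrite u1 mulr1; ring.
Qed.

Lemma Rintegral_disc_sqdist (a : R * R) :
  \int[mu2]_(x in D) enorm (x - a) ^+ 2 = pi / 2 + (a.1 ^+ 2 + a.2 ^+ 2) * pi.
Proof.
have [m2 m1 m1' m0] := @disc_moments R.
rewrite (Rintegral_sqdist _ _ measurable_unit_disc (@subset_refl _ _)).
by rewrite m2 m1 m1' m0; ring.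
Qed.

End distortion.

(** * Existence of optimal sets *)

Section existence.
Context {R : realType}.
Local Notation mu2 := (@lebesgue2 R).
Local Notation D := (@unit_disc R).
Local Notation fset3 a b c := ([fset a; b; c]%fset : {fset R * R}).

Lemma integral_mindist2_lty (alpha : {fset R * R}) a : a \in alpha ->
  (\int[mu2]_(x in D) mindist2 alpha x < +oo)%E.
Proof.
move=> aa; have mD := @measurable_unit_disc R.
apply: (@le_lt_trans _ _ (\int[mu2]_(x in D) (2 + 2 * (a.1 ^+ 2 + a.2 ^+ 2))%:E)%E); last first.
  rewrite integral_cst//; last first.
  by rewrite [X in (_ * X)%E]lebesgue2_unit_disc -EFinM ltry.
apply: ge0_le_integral => //.
- by move=> x _; exact: mindist2_ge0.
- by apply: measurable_funTS; exact: measurable_mindist2.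
- move=> x Dx; apply: (le_trans (mindist2_le _ _ x aa)); rewrite lee_fin.
  rewrite sqr_sqrtr ?addr_ge0 ?sqr_ge0//=; move: Dx; rewrite /unit_disc/=.
  have := sqr_ge0 (x.1 + a.1); have := sqr_ge0 (x.2 + a.2); nra.
Qed.

(** Allowing repetitions lets triples of points parametrize all nonempty competitors at once. *)
Lemma fset_card_le3 (alpha : {fset R * R}) : (#|` alpha| <= 3)%N ->
  alpha = fset0 \/ exists a b c, alpha = fset3 a b c.
Proof.
move E : (enum_fset alpha) => s.
have mE x : (x \in alpha) = (x \in s) by rewrite -E.
case: s mE {E} => [|a [|b [|c [|//]]]] mE _.
- by left; apply/fsetP => x; rewrite mE.
- by right; exists a, a, a; apply/fsetP => x; rewrite mE !inE !orbb.
- by right; exists a, a, b; apply/fsetP => x; rewrite mE !inE orbb.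
- by right; exists a, b, c; apply/fsetP => x; rewrite mE !inE orbA.
Qed.

Lemma card_fset3_le3 (a b c : R * R) : (#|` fset3 a b c| <= 3)%N.
Proof.
rewrite (leq_trans (leq_card_fsetU _ _).1)// cardfs1 addn1 ltnS.
by rewrite (leq_trans (leq_card_fsetU _ _).1)// !cardfs1.
Qed.

(** A compact convex set containing D. Being a product, it has the coordinatewise clamp as
    nearest-point projection, which brings no point farther from D. *)
Definition square : set (R * R) := `[-1, 1] `*` `[-1, 1].

Definition clamp (t : R) : R := Num.max (-1) (Num.min t 1).

Lemma clamp_itv t : clamp t \in `[-1, 1].
Proof.
rewrite in_itv/= /clamp; apply/andP; split; first by rewrite le_max lexx.
by rewrite ge_max ge_min lexx orbT andbT; lra.
Qed.

Lemma clamp_le (s t : R) : -1 <= s <= 1 -> (s - clamp t) ^+ 2 <= (s - t) ^+ 2.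
Proof.
move=> /andP[s1 s2]; rewrite /clamp.
have [t1|t1] := leP t 1; last by rewrite max_r; [nra|lra].
by have [t2|t2] := leP (-1) t; [rewrite lexx|nra].
Qed.

Lemma clamp_dist (x a : R * R) : D x ->
  enorm (x - (clamp a.1, clamp a.2)) ^+ 2 <= enorm (x - a) ^+ 2.
Proof.
move=> /disc_coord []; rewrite !ler_norml => x1 x2.
by rewrite !sqr_sqrtr ?addr_ge0 ?sqr_ge0//= lerD// clamp_le.
Qed.

(** In each coordinate the difference of squares factors as (q - p)(2 s - p - q), whose second
    factor is at most 4 in absolute value on the square. *)
Lemma sqdist_perturb (x a b : R * R) (d : R) : D x -> square a -> square b ->
  `|a.1 - b.1| <= d -> `|a.2 - b.2| <= d ->
  enorm (x - a) ^+ 2 <= enorm (x - b) ^+ 2 + 8 * d.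
Proof.
move=> /disc_coord[n1 n2]; rewrite /square/= !in_itv/=.
move=> [/andP[a1 a2] /andP[a3 a4]] [/andP[b1 b2] /andP[b3 b4]] d1 d2.
move: n1 n2; rewrite !ler_norml => /andP[x1 x2] /andP[x3 x4].
have key (s p q : R) : -1 <= s -> s <= 1 -> -1 <= p -> p <= 1 -> -1 <= q -> q <= 1 ->
    `|p - q| <= d -> (s - p) ^+ 2 <= (s - q) ^+ 2 + 4 * d.
  move=> s1 s2 p1 p2 q1 q2 pq.
  have -> : (s - p) ^+ 2 = (s - q) ^+ 2 + (q - p) * (2 * s - p - q) by ring.
  rewrite lerD2l (le_trans (ler_norm _))// normrM distrC mulrC ler_pM//.
  by rewrite ler_norml; apply/andP; split; lra.
rewrite !sqr_sqrtr ?addr_ge0 ?sqr_ge0//=.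
have := key x.1 a.1 b.1 x1 x2 a1 a2 b1 b2 d1; have := key x.2 a.2 b.2 x3 x4 a3 a4 b3 b4 d2.
lra.
Qed.

Definition objective (p : R * R * (R * R) * (R * R)) : R :=
  fine (\int[mu2]_(x in D) mindist2 (fset3 p.1.1 p.1.2 p.2) x)%E.

Lemma objectiveE p :
  (\int[mu2]_(x in D) mindist2 (fset3 p.1.1 p.1.2 p.2) x = (objective p)%:E)%E.
Proof.
rewrite /objective fineK// ge0_fin_numE; last first.
  by apply: integral_ge0 => x _; exact: mindist2_ge0.
by apply: (@integral_mindist2_lty _ p.2); rewrite !inE eqxx !orbT.
Qed.

Local Notation cube := (square `*` square `*` square).

(** Replacing each point of q by its counterpart in p costs at most 8 d pointwise, and D has area
    pi. Used in both directions, this is a Lipschitz bound. *)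
Lemma objective_perturb (p q : R * R * (R * R) * (R * R)) (d : R) : 0 <= d -> cube p -> cube q ->
  ball p d q -> objective p <= objective q + 8 * d * pi.
Proof.
move=> d0 [[p1 p2] p3] [[q1 q2] q3] [[[b1 b2] [b3 b4]] [b5 b6]].
have mD := @measurable_unit_disc R.
rewrite -lee_fin EFinD -!objectiveE.
have -> : ((8 * d * pi)%:E = \int[mu2]_(x in D) (8 * d)%:E)%E.
  by rewrite integral_cst//= [X in (_ * X)%E]lebesgue2_unit_disc -EFinM.
have mm alpha : measurable_fun D (@mindist2 R alpha).
  by apply: measurable_funTS; exact: measurable_mindist2.
have m0 alpha x : D x -> (0 <= @mindist2 R alpha x)%E by move=> _; exact: mindist2_ge0.
have d8 x : D x -> (0 <= (8 * d)%:E)%E by rewrite lee_fin mulr_ge0.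
rewrite -(ge0_integralD mu2 mD (m0 _) (mm _) d8)//.
apply: ge0_le_integral => //; [exact: m0|exact: mm| |].
  by apply: emeasurable_funD => //; exact: mm.
move=> x Dx; rewrite -leeBlDr//; apply: le_mindist2 => b bq; rewrite leeBlDr//.
have [a ap ab] : exists2 a, a \in fset3 p.1.1 p.1.2 p.2 &
    enorm (x - a) ^+ 2 <= enorm (x - b) ^+ 2 + 8 * d.
  move: bq; rewrite !inE => /orP[/orP[]|] /eqP ->.
  - exists p.1.1; first by rewrite !inE eqxx.
    by apply: sqdist_perturb => //; exact: ltW.
  - exists p.1.2; first by rewrite !inE eqxx orbT.
    by apply: sqdist_perturb => //; exact: ltW.
  - exists p.2; first by rewrite !inE eqxx !orbT.
    by apply: sqdist_perturb => //; exact: ltW.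
by apply: (le_trans (mindist2_le _ _ x ap)); rewrite -EFinD lee_fin.
Qed.

Lemma objective_continuous : {within cube, continuous objective}.
Proof.
apply/subspace_continuousP => p Kp; apply/cvgrPdist_le => e e0.
have pi0 := @pi_gt0 R.
pose d := e / (8 * pi).
have d0 : 0 < d by rewrite divr_gt0// mulr_gt0.
have ed : 8 * d * pi = e by rewrite /d mulrAC mulrC divfK// gt_eqF// mulr_gt0.
near=> q.
have Kq : cube q by near: q; exact: withinT.
have bpq : ball p d q by near: q; apply: cvg_within; exact: nbhsx_ballx.
have := objective_perturb _ _ _ (ltW d0) Kp Kq bpq.
have := objective_perturb _ _ _ (ltW d0) Kq Kp (ball_sym bpq).
by rewrite ed /= /from_subspace ler_norml => ? ?; apply/andP; split; lra.
Unshelve. all: by end_near. Qed.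

Lemma exists_optimal : exists alpha, optimal_means (@uniform_disc R) 3 alpha.
Proof.
have pi0 := @pi_gt0 R.
have mD := @measurable_unit_disc R.
have csq : compact square by apply: compact_setX; exact: segment_compact.
have ccube : compact cube by do 2 apply: compact_setX => //.
have cl (a : R * R) : square (clamp a.1, clamp a.2) by split; exact: clamp_itv.
have cube0 : cube !=set0.
  have s0 : square 0 by split; rewrite /= in_itv/=; apply/andP; split; lra.
  by exists ((0, 0), 0); split => //; split.
have [p _ pmin] := compact_EVT_min cube0 ccube objective_continuous.
exists (fset3 p.1.1 p.1.2 p.2); split; first exact: card_fset3_le3.
apply/eqP; rewrite eq_le; apply/andP; split; last first.
  apply: ereal_inf_lbound; exists (fset3 p.1.1 p.1.2 p.2) => //=.
  exact: card_fset3_le3.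
apply: le_ereal_inf_tmp => _ [alpha /= a3 <-].
(* The empty set has infinite distortion. Any other competitor is clamped into the cube, which does
   not increase its distortion. *)
have [->|[a [b [c ->]]]] := fset_card_le3 _ a3.
  have -> : distortion (@uniform_disc R) fset0 = +oo%E.
    rewrite distortionE.
    have -> : (\int[mu2]_(x in D) mindist2 fset0 x = \int[mu2]_(x in D) +oo)%E.
      by apply: eq_integral => x _; rewrite /mindist2 big_nil.
    rewrite integral_cst// [X in (_ * (_ * X))%E]lebesgue2_unit_disc.
    by rewrite !gt0_mulye ?gt0_muley ?lte_fin ?invr_gt0.
  exact: leey.
rewrite !distortionE lee_pmul2l//; last first.
  by rewrite lte_fin invr_gt0.
pose q := ((clamp a.1, clamp a.2), (clamp b.1, clamp b.2), (clamp c.1, clamp c.2)).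
have Kq : q \in cube by rewrite inE; split; [split|]; exact: cl.
apply: (@le_trans _ _ (objective q)%:E); first by rewrite objectiveE lee_fin pmin.
rewrite -objectiveE; apply: ge0_le_integral => //.
- by move=> x _; exact: mindist2_ge0.
- by apply: measurable_funTS; exact: measurable_mindist2.
- by apply: measurable_funTS; exact: measurable_mindist2.
move=> x Dx; apply: le_mindist2 => z; rewrite !inE => /orP[/orP[]|] /eqP ->.
- apply: le_trans (mindist2_le _ (clamp a.1, clamp a.2) x _) _; first by rewrite !inE eqxx.
  by rewrite lee_fin clamp_dist.
- apply: le_trans (mindist2_le _ (clamp b.1, clamp b.2) x _) _; first by rewrite !inE eqxx orbT.
  by rewrite lee_fin clamp_dist.
- apply: le_trans (mindist2_le _ (clamp c.1, clamp c.2) x _) _; first by rewrite !inE eqxx !orbT.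
  by rewrite lee_fin clamp_dist.
Qed.

End existence.

(** * Optimal sets and sectors *)

Section sectors.
Context {R : realType}.
Local Notation mu2 := (@lebesgue2 R).
Local Notation D := (@unit_disc R).
Local Notation R2 := (measurableTypeR R * measurableTypeR R)%type.
Local Notation fset3 a b c := ([fset a; b; c]%fset : {fset R * R}).
Local Notation unitv u := (u.1 ^+ 2 + u.2 ^+ 2 = 1).
Local Notation r := (Num.sqrt 3 / pi).

(* A unit vector orthogonal to u and not on the side of v lies in neither wedge. *)
Lemma not_two_wedges (u v : R * R) : unitv u -> ~ (D `<=` wedge u `|` wedge v).
Proof.
move=> u1 cov.
pose w : R * R := if dotp (- u.2, u.1) v <= 0 then (- u.2, u.1) else (u.2, - u.1).
have w1 : unitv w by rewrite /w; case: ifP => _ /=; rewrite sqrrN addrC.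
have wu : dotp w u = 0 by rewrite /w /dotp; case: ifP => _ /=; ring.
have wv : dotp w v <= 0.
  rewrite /w; have [h|h] := leP (dotp (- u.2, u.1) v) 0; first by [].
  by rewrite /dotp/= in h *; lra.
have /cov[|] : D w by rewrite /unit_disc/= w1.
- by case=> _; rewrite /enorm w1 sqrtr1 wu; lra.
- by case=> _; rewrite /enorm w1 sqrtr1; lra.
Qed.

(** Let p and s be the coordinates of x along u and along its quarter turn. Outside the first wedge,
    the sign of s tells which of the other two contains x. *)
Lemma three_wedges_cover (u : R * R) : unitv u ->
  D `<=` wedge u
    `|` wedge (- u.1 / 2 - Num.sqrt 3 / 2 * u.2, Num.sqrt 3 / 2 * u.1 - u.2 / 2)
    `|` wedge (- u.1 / 2 + Num.sqrt 3 / 2 * u.2, - (Num.sqrt 3 / 2 * u.1) - u.2 / 2).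
Proof.
move=> u1 x Dx; have s3 : 0 < Num.sqrt 3 :> R by rewrite sqrtr_gt0.
have s32 : Num.sqrt 3 ^+ 2 = 3 :> R by rewrite sqr_sqrtr.
rewrite /wedge /dotp/=.
pose p := x.1 * u.1 + x.2 * u.2; pose s := x.2 * u.1 - x.1 * u.2.
set S := Num.sqrt 3 in s3 s32 *.
have n0 : 0 <= enorm x by exact: sqrtr_ge0.
have n2 : enorm x ^+ 2 = p ^+ 2 + s ^+ 2.
  rewrite sqr_sqrtr ?addr_ge0 ?sqr_ge0// /p /s.
  by rewrite -[LHS]mulr1 -u1; ring.
have -> : x.1 * (- u.1 / 2 - S / 2 * u.2) + x.2 * (S / 2 * u.1 - u.2 / 2) = (S * s - p) / 2.
  by rewrite /p /s; field.
have -> : x.1 * (- u.1 / 2 + S / 2 * u.2) + x.2 * (- (S / 2 * u.1) - u.2 / 2) = (- (S * s) - p) / 2.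
  by rewrite /p /s; field.
rewrite -/p; move: (enorm x) n0 n2 => n n0 n2.
have [np|pn] := leP n (2 * p); first by left; left.
(* Since s^2 = n^2 - p^2, the difference 3 s^2 - (n + p)^2 equals 2 (n + p)(n - 2 p), which is
   nonnegative here. *)
have key : n + p <= S * `|s|.
  rewrite -ler_sqr ?nnegrE; last 2 first.
  - by nra.
  - by rewrite mulr_ge0// ltW.
  rewrite exprMn s32 real_normK ?num_real//.
  have np0 : 0 <= n + p by nra.
  have : 0 <= (n + p) * (n - 2 * p) by rewrite mulr_ge0// subr_ge0 ltW.
  lra.
have [s0|s0] := leP 0 s.
  by left; right; split => //; rewrite ger0_norm// in key; lra.
by right; split => //; rewrite ltr0_norm// in key; lra.
Qed.

Lemma ge0_integral_setU_le (A B : set R2) (f : R2 -> \bar R) : measurable A -> measurable B ->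
  measurable_fun setT f -> (forall x, 0 <= f x)%E ->
  (\int[mu2]_(x in A `|` B) f x <= \int[mu2]_(x in A) f x + \int[mu2]_(x in B) f x)%E.
Proof.
move=> mA mB mf f0.
have -> : A `|` B = A `|` (B `\` A).
  apply/seteqP; split => x; last by move=> [Ax|[Bx _]]; [left|right].
  by have [Ax|nAx] := pselect (A x); [left|move=> [//|Bx]; right].
rewrite ge0_integral_setU//; last 3 first.
- exact: measurableD.
- exact: measurable_funTS.
- by apply/disj_setPS => x [? []].
rewrite leeD2l// ge0_subset_integral//; last exact: measurable_funTS.
exact: measurableD.
Qed.

Lemma Rintegral_three (A B C : set R2) (f : R2 -> R) :
  measurable A -> measurable B -> measurable C ->
  A `|` B `|` C = D -> mu2.-integrable D (EFin \o f) ->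
  mu2 (A `&` B) = 0%E -> mu2 (A `&` C) = 0%E -> mu2 (B `&` C) = 0%E ->
  \int[mu2]_(x in D) f x =
  \int[mu2]_(x in A) f x + \int[mu2]_(x in B) f x + \int[mu2]_(x in C) f x.
Proof.
move=> mA mB mC <- fi AB AC BC.
rewrite Rintegral_setU_null//; last 2 first.
- exact: measurableU.
- rewrite setIUl; apply/eqP; rewrite eq_le measure_ge0 andbT.
  rewrite (le_trans (measureU2 _ _ _))//; [exact: measurableI|exact: measurableI|].
  by rewrite [X in (X + _)%E]AC [X in (_ + X)%E]BC adde0.
rewrite Rintegral_setU_null//.
apply: integrableS fi; [by apply: measurableU => //; exact: measurableU|exact: measurableU|].
by move=> x ABx; left.
Qed.

Definition sector_structure alpha (a b c u v w : R * R) : Prop :=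
  [/\ alpha = fset3 a b c, [/\ a != b, a != c & b != c],
      [/\ unitv u, unitv v & unitv w],
      [/\ voronoi alpha a `&` D = wedge u, voronoi alpha b `&` D = wedge v
        & voronoi alpha c `&` D = wedge w] &
      wedge u `|` wedge v `|` wedge w = D /\
      [/\ mu2 (wedge u `&` wedge v) = 0%E, mu2 (wedge u `&` wedge w) = 0%E
        & mu2 (wedge v `&` wedge w) = 0%E]].

Lemma sector_structureP (alpha : {fset R * R}) : (#|` alpha| <= 3)%N ->
  voronoi_sector_partition (2 * pi / 3) alpha ->
  exists a b c u v w, sector_structure alpha a b c u v w.
Proof.
move=> a3 [cov null sec].
have secw z : z \in alpha -> exists2 u, unitv u & voronoi alpha z `&` D = wedge u.
  move=> /sec[theta ->]; exists (cos (theta + pi / 3), sin (theta + pi / 3)).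
    by rewrite /= cos2Dsin2.
  exact: sectorE.
have [alpha0|[a [b [c abc]]]] := fset_card_le3 _ a3.
  have D0 : D 0 by rewrite /unit_disc/= expr0n addr0 ler01.
  by move: D0; rewrite -cov => -[z /=]; rewrite alpha0.
have aa : a \in alpha by rewrite abc !inE eqxx.
have ba : b \in alpha by rewrite abc !inE eqxx orbT.
have ca : c \in alpha by rewrite abc !inE eqxx !orbT.
have [u u1 au] := secw a aa; have [v v1 bv] := secw b ba; have [w w1 cw] := secw c ca.
have covD : wedge u `|` wedge v `|` wedge w = D.
  rewrite -au -bv -cw -[RHS]cov; apply/seteqP; split => x.
    by move=> [[]|] h; [exists a|exists b|exists c].
  move=> [z /=]; rewrite abc !inE => /orP[/orP[]|] /eqP -> h; rewrite -abc in h *.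
  - by left; left.
  - by left; right.
  - by right.
(* If two of the points coincided, two wedges would already cover D. *)
have ab : a != b.
  apply/eqP => ab; apply: (@not_two_wedges v w v1).
  by rewrite -covD -au ab bv setUid.
have ac : a != c.
  apply/eqP => ac; apply: (@not_two_wedges v w v1).
  by rewrite -covD -au ac cw setUC setUA setUid setUC.
have bc : b != c.
  apply/eqP => bc; apply: (@not_two_wedges u w u1).
  by rewrite -covD -bv bc cw -setUA setUid.
have nul y z s t : y \in alpha -> z \in alpha -> y != z ->
    voronoi alpha y `&` D = wedge s -> voronoi alpha z `&` D = wedge t ->
    mu2 (wedge s `&` wedge t) = 0%E.
  move=> ya za yz <- <-; rewrite setIACA setIid; exact: null.
exists a, b, c, u, v, w; split => //; split => //; split.
- exact: (nul a b).
- exact: (nul a c).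
- exact: (nul b c).
Qed.

End sectors.

(** * Moments forced by a sector partition; cost of sectors and of triangles *)

Section optimal.
Context {R : realType}.
Local Notation mu2 := (@lebesgue2 R).
Local Notation D := (@unit_disc R).
Local Notation R2 := (measurableTypeR R * measurableTypeR R)%type.
Local Notation fset3 a b c := ([fset a; b; c]%fset : {fset R * R}).
Local Notation unitv u := (u.1 ^+ 2 + u.2 ^+ 2 = 1).
Local Notation r := (Num.sqrt 3 / pi).

Lemma integrable_sqdist A (a : R * R) : measurable A -> A `<=` D ->
  mu2.-integrable A (EFin \o (fun x : R * R => enorm (x - a) ^+ 2)).
Proof.
move=> mA AD; apply: (integrable_disc A _ (2 + 2 * (a.1 ^+ 2 + a.2 ^+ 2))) => //.
  apply: measurable_funX; apply: (measurableT_comp measurable_enorm).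
  by apply: measurable_fun_pair; apply: measurable_funB.
move=> x; rewrite /unit_disc/= ger0_norm ?sqr_ge0// sqr_sqrtr ?addr_ge0 ?sqr_ge0//=.
have := sqr_ge0 (x.1 + a.1); have := sqr_ge0 (x.2 + a.2); nra.
Qed.

Lemma sector_moments alpha (a b c u v w : R * R) : sector_structure alpha a b c u v w ->
  [/\ \int[mu2]_(x in wedge (1, 0)) (x.1 ^+ 2 + x.2 ^+ 2) = pi / 6,
      \int[mu2]_(x in wedge (1, 0)) (1 : R) = pi / 3,
      u.1 + v.1 + w.1 = 0 & u.2 + v.2 + w.2 = 0].
Proof.
move=> [_ _ [u1 v1 w1] _ [covD [uv uw vw]]].
have mW := @measurable_wedge R; have s3 : 0 < Num.sqrt 3 :> R by rewrite sqrtr_gt0.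
have pi0 := @pi_gt0 R.
have E (z : R * R) := Rintegral_three (wedge u) (wedge v) (wedge w) _ (mW u) (mW v) (mW w) covD
  (integrable_sqdist D z measurable_unit_disc (@subset_refl _ _)) uv uw vw.
have {}E (z : R * R) := E z.
move: E; set q := \int[_]_(x in _) (_ + _); set m := \int[_]_(x in _) 1 => E.
have {}E (x y : R) : pi / 2 + (x ^+ 2 + y ^+ 2) * pi = 3 * q
    - 2 * (Num.sqrt 3 / 3) * (x * (u.1 + v.1 + w.1) + y * (u.2 + v.2 + w.2))
    + 3 * (x ^+ 2 + y ^+ 2) * m.
  have := E (x, y); rewrite Rintegral_disc_sqdist !Rintegral_wedge_sqdist// -/q -/m /dotp/= => ->.
  by ring.
(* Both sides are polynomials in (x, y); compare their coefficients. *)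
have E00 := E 0 0; have E10 := E 1 0; have EN0 := E (-1) 0; have E01 := E 0 1.
have qE : q = pi / 6 by lra.
have mE : m = pi / 3 by lra.
split => //.
  have : Num.sqrt 3 * (u.1 + v.1 + w.1) = 0 by lra.
  by move/eqP; rewrite mulf_eq0 gt_eqF//= => /eqP.
have : Num.sqrt 3 * (u.2 + v.2 + w.2) = 0 by lra.
by move/eqP; rewrite mulf_eq0 gt_eqF//= => /eqP.
Qed.

(** Completing the square around the centroid: r = (sqrt 3 / 3) / (pi / 3) is first moment over
    area, and 1 / pi = (pi / 3) r^2 is the gain over the cost at the origin. *)
Lemma wedge_cost (u a : R * R) : unitv u ->
  \int[mu2]_(x in wedge (1, 0)) (x.1 ^+ 2 + x.2 ^+ 2) = pi / 6 ->
  \int[mu2]_(x in wedge (1, 0)) (1 : R) = pi / 3 ->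
  \int[mu2]_(x in wedge u) enorm (x - a) ^+ 2 =
  pi / 6 - pi^-1 + pi / 3 * ((a.1 - r * u.1) ^+ 2 + (a.2 - r * u.2) ^+ 2).
Proof.
move=> u1 q m; rewrite Rintegral_wedge_sqdist// q m /dotp.
have pi0 := @pi_gt0 R; have s32 : Num.sqrt 3 ^+ 2 = 3 :> R by rewrite sqr_sqrtr.
transitivity (pi / 6 - Num.sqrt 3 ^+ 2 * (u.1 ^+ 2 + u.2 ^+ 2) / 3 / pi
  + pi / 3 * ((a.1 - r * u.1) ^+ 2 + (a.2 - r * u.2) ^+ 2)).
  move: (Num.sqrt 3) (pi : R) pi0 => s p p0; field; lra.
by rewrite u1 s32 mulr1 divff ?mul1r ?pnatr_eq0.
Qed.

Lemma sector_distortion alpha (a b c u v w : R * R) : sector_structure alpha a b c u v w ->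
  distortion (@uniform_disc R) alpha =
  (2^-1 - 3 / pi ^+ 2 + 3^-1 *
    (((a.1 - r * u.1) ^+ 2 + (a.2 - r * u.2) ^+ 2)
    + ((b.1 - r * v.1) ^+ 2 + (b.2 - r * v.2) ^+ 2)
    + ((c.1 - r * w.1) ^+ 2 + (c.2 - r * w.2) ^+ 2)))%:E.
Proof.
move=> st; have [q m _ _] := sector_moments _ _ _ _ _ _ _ st.
case: (st) => abc _ [u1 v1 w1] [au bv cw] [covD [uv uw vw]].
have mW := @measurable_wedge R; have mD := @measurable_unit_disc R; have pi0 := @pi_gt0 R.
have aa : a \in alpha by rewrite abc !inE eqxx.
have ba : b \in alpha by rewrite abc !inE eqxx orbT.
have ca : c \in alpha by rewrite abc !inE eqxx !orbT.
(* A real-valued copy of the integrand, so that additivity of real integrals over the three cells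
   applies. *)
pose f x := fine (mindist2 alpha x).
have fE x : mindist2 alpha x = (f x)%:E.
  rewrite /f fineK// ge0_fin_numE ?mindist2_ge0//.
  by apply: (le_lt_trans (mindist2_le _ _ _ aa)); rewrite ltry.
clearbody f.
have fi : mu2.-integrable D (EFin \o f).
  apply/integrableP; split.
    apply: (eq_measurable_fun (mindist2 alpha)) => [x _|]; first by rewrite /= fE.
    by apply: measurable_funTS; exact: measurable_mindist2.
  apply: le_lt_trans (integral_mindist2_lty _ _ aa).
  rewrite le_eqVlt; apply/orP; left; apply/eqP; apply: eq_integral => x _.
  by rewrite fE/= ger0_norm// -lee_fin -fE mindist2_ge0.
have fw z t : z \in alpha -> voronoi alpha z `&` D = wedge t ->
    \int[mu2]_(x in wedge t) f x = \int[mu2]_(x in wedge t) enorm (x - z) ^+ 2.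
  move=> za zt; apply: eq_Rintegral => x; rewrite inE -zt => -[vx _].
  by apply: EFin_inj; rewrite -fE (voronoi_mindist2 _ _ _ za vx).
rewrite distortionE.
have -> : (\int[mu2]_(x in D) mindist2 alpha x = (\int[mu2]_(x in D) f x)%R%:E)%E.
  rewrite /Rintegral fineK; last exact: integrable_fin_num.
  by apply: eq_integral => x _; rewrite fE.
rewrite (Rintegral_three _ _ _ f (mW u) (mW v) (mW w) covD fi uv uw vw).
apply: (etrans (esym (EFinM _ _))); congr EFin.
rewrite (fw a u)// (fw b v)// (fw c w)// !wedge_cost//.
move: (Num.sqrt 3) (pi : R) pi0 => s p p0; field; lra.
Qed.

(* The vertices are r u and its rotations by 2pi/3 and -2pi/3. *)
Definition triangle (u : R * R) : {fset R * R} :=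
  fset3 (r * u.1, r * u.2)
    (r * (- u.1 / 2 - Num.sqrt 3 / 2 * u.2), r * (Num.sqrt 3 / 2 * u.1 - u.2 / 2))
    (r * (- u.1 / 2 + Num.sqrt 3 / 2 * u.2), r * (- (Num.sqrt 3 / 2 * u.1) - u.2 / 2)).

(** On each wedge the minimum is at most the squared distance to that wedge's own vertex, so a
    covering suffices for the upper bound. Equality will come from optimality. *)
Lemma triangle_distortion (u : R * R) : unitv u ->
  \int[mu2]_(x in wedge (1, 0)) (x.1 ^+ 2 + x.2 ^+ 2) = pi / 6 ->
  \int[mu2]_(x in wedge (1, 0)) (1 : R) = pi / 3 ->
  (distortion (@uniform_disc R) (triangle u) <= (2^-1 - 3 / pi ^+ 2)%:E)%E.
Proof.
move=> u1 q m; rewrite distortionE; have mW := @measurable_wedge R.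
have mD := @measurable_unit_disc R; have pi0 := @pi_gt0 R.
have s32 : Num.sqrt 3 ^+ 2 = 3 :> R by rewrite sqr_sqrtr.
have := three_wedges_cover u u1; set v := (X in _ `|` wedge X `|` _) => cov.
have v1 : unitv v.
  rewrite /v/=; transitivity ((u.1 ^+ 2 + u.2 ^+ 2) * (1 + Num.sqrt 3 ^+ 2) / 4); first by field.
  by rewrite u1 s32; field.
move: cov; set w := (X in _ `|` wedge X) => cov.
have w1 : unitv w.
  rewrite /w/=; transitivity ((u.1 ^+ 2 + u.2 ^+ 2) * (1 + Num.sqrt 3 ^+ 2) / 4); first by field.
  by rewrite u1 s32; field.
have mm := measurable_mindist2 (triangle u); have m0 := mindist2_ge0 (triangle u).
have cost t : unitv t -> (r * t.1, r * t.2) \in triangle u ->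
    (\int[mu2]_(x in wedge t) mindist2 (triangle u) x <= (pi / 6 - pi^-1)%:E)%E.
  move=> t1 tu; have -> : (pi / 6 - pi^-1)%:E =
      (\int[mu2]_(x in wedge t) (enorm (x - (r * t.1, r * t.2)) ^+ 2)%:E)%E.
    have := wedge_cost t (r * t.1, r * t.2) t1 q m.
    rewrite /= !subrr expr0n addr0 mulr0 addr0 => <-.
    rewrite /Rintegral fineK//.
    have h := integrable_sqdist _ (r * t.1, r * t.2) (mW t) (wedge_disc t).
    by apply: integrable_fin_num; [exact: mW|exact: h].
  apply: ge0_le_integral => //; first exact: mW.
  - exact: measurable_funTS.
  - have /integrableP[] := integrable_sqdist _ (r * t.1, r * t.2) (mW t) (wedge_disc t); exact.
  - by move=> x _; exact: mindist2_le.
have cover : (\int[mu2]_(x in D) mindist2 (triangle u) x <= (pi / 2 - 3 / pi)%:E)%E.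
  apply: (@le_trans _ _
    (\int[mu2]_(x in wedge u `|` wedge v `|` wedge w) mindist2 (triangle u) x)%E).
    apply: ge0_subset_integral => //; last exact: measurable_funTS.
    by apply: measurableU; [apply: measurableU|]; exact: mW.
  have mWuv : measurable (wedge u `|` wedge v : set R2) by apply: measurableU; exact: mW.
  apply: (le_trans (ge0_integral_setU_le _ _ _ mWuv (mW w) mm m0)).
  have -> : (pi / 2 - 3 / pi : R)%:E =
      ((pi / 6 - pi^-1)%:E + (pi / 6 - pi^-1)%:E + (pi / 6 - pi^-1)%:E)%E.
    by rewrite -!EFinD; congr EFin; lra.
  apply: leeD; last by apply: cost => //; rewrite !inE eqxx !orbT.
  apply: (le_trans (ge0_integral_setU_le _ _ _ (mW u) (mW v) mm m0)).
  apply: leeD; first by apply: cost => //; rewrite !inE eqxx.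
  by apply: cost => //; rewrite !inE eqxx orbT.
have -> : (2^-1 - 3 / pi ^+ 2 : R)%:E = ((pi^-1 : R)%:E * (pi / 2 - 3 / pi : R)%:E)%E.
  rewrite -EFinM; congr EFin; move: (pi : R) pi0 => p p0; field; lra.
by rewrite lee_pmul2l// lte_fin invr_gt0.
Qed.

End optimal.

(** * Rigidity of optimal sets, uncountability and the decimal value *)

Section conclusion.
Context {R : realType}.
Local Notation unitv u := (u.1 ^+ 2 + u.2 ^+ 2 = 1).
Local Notation r := (Num.sqrt 3 / pi).
Local Notation P := (@uniform_disc R).

Lemma quantization_error_le n (alpha : {fset R * R}) : (#|` alpha| <= n)%N ->
  (quantization_error P n <= distortion P alpha)%E.
Proof. by move=> an; apply: ereal_inf_lbound; exists alpha. Qed.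

(** Comparison with one triangle shows that the excess over 1/2 - 3/pi^2, a positive multiple of a
    sum of six squares, is at most 0; hence every square vanishes. *)
Lemma optimal_sectors (alpha : {fset R * R}) (a b c u v w : R * R) :
  optimal_means P 3 alpha -> sector_structure alpha a b c u v w ->
  [/\ quantization_error P 3 = (2^-1 - 3 / pi ^+ 2)%:E,
      a = (r * u.1, r * u.2), b = (r * v.1, r * v.2) & c = (r * w.1, r * w.2)].
Proof.
move=> [a3 optE] st; have [q m _ _] := sector_moments _ _ _ _ _ _ _ st.
have [_ _ [u1 _ _] _ _] := st.
have dE := sector_distortion _ _ _ _ _ _ _ st.
have := le_trans (quantization_error_le _ _ (card_fset3_le3 _ _ _)) (triangle_distortion u u1 q m).
rewrite -optE dE lee_fin gerDl.
set s1 := (a.1 - _) ^+ 2; set s2 := (a.2 - _) ^+ 2; set s3 := (b.1 - _) ^+ 2.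
set s4 := (b.2 - _) ^+ 2; set s5 := (c.1 - _) ^+ 2; set s6 := (c.2 - _) ^+ 2 => le0.
have p1 : 0 <= s1 := sqr_ge0 _; have p2 : 0 <= s2 := sqr_ge0 _.
have p3 : 0 <= s3 := sqr_ge0 _; have p4 : 0 <= s4 := sqr_ge0 _.
have p5 : 0 <= s5 := sqr_ge0 _; have p6 : 0 <= s6 := sqr_ge0 _.
have zero (x y : R) : (x - y) ^+ 2 = 0 -> x = y.
  by move=> /eqP; rewrite sqrf_eq0 subr_eq0 => /eqP.
split.
- have s0 : s1 + s2 + (s3 + s4) + (s5 + s6) = 0 by lra.
  by rewrite s0 mulr0 addr0.
- by rewrite [a]surjective_pairing; congr (_, _); apply: zero; rewrite -/s1 -/s2; lra.
- by rewrite [b]surjective_pairing; congr (_, _); apply: zero; rewrite -/s3 -/s4; lra.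
- by rewrite [c]surjective_pairing; congr (_, _); apply: zero; rewrite -/s5 -/s6; lra.
Qed.

Lemma optimal_triangle (alpha : {fset R * R}) (a b c u v w : R * R) :
  optimal_means P 3 alpha -> sector_structure alpha a b c u v w ->
  equilateral_triangle alpha /\ inscribed_in_circle (3 / pi ^+ 2) alpha.
Proof.
move=> opt st; have [_ aE bE cE] := optimal_sectors _ _ _ _ _ _ _ opt st.
have [_ _ m1 m2] := sector_moments _ _ _ _ _ _ _ st.
have [abc [ab ac bc] [u1 v1 w1] _ _] := st.
have pi0 := @pi_gt0 R; have s32 : Num.sqrt 3 ^+ 2 = 3 :> R by rewrite sqr_sqrtr.
have r2 : r ^+ 2 = 3 / pi ^+ 2 :> R by rewrite expr_div_n s32.
have circ (t : R * R) : unitv t -> (r * t.1) ^+ 2 + (r * t.2) ^+ 2 = 3 / pi ^+ 2.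
  move=> t1; rewrite -r2 -[RHS]mulr1 -t1; ring.
split; last first.
  by move=> z; rewrite abc !inE => /orP[/orP[]|] /eqP ->; rewrite ?aE ?bE ?cE circ.
split.
  by rewrite abc -!fsetUA !cardfsU1 !inE cardfs1 (negbTE ab) (negbTE ac) (negbTE bc).
(* s + t + z = 0 and |z| = 1 force <s, t> = - 1/2, hence |s - t|^2 = 3. *)
have side (s t z : R * R) : unitv s -> unitv t -> unitv z ->
    s.1 + t.1 + z.1 = 0 -> s.2 + t.2 + z.2 = 0 ->
    enorm ((r * s.1, r * s.2) - (r * t.1, r * t.2)) = Num.sqrt (3 * (3 / pi ^+ 2)).
  move=> s1 t1 z1 e1 e2; rewrite /enorm/=; congr Num.sqrt; rewrite -r2.
  have z1E : z.1 = - (s.1 + t.1) by lra.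
  have z2E : z.2 = - (s.2 + t.2) by lra.
  have st3 : (s.1 - t.1) ^+ 2 + (s.2 - t.2) ^+ 2 = 3.
    by move: z1; rewrite z1E z2E; lra.
  transitivity (((s.1 - t.1) ^+ 2 + (s.2 - t.2) ^+ 2) * r ^+ 2); first by ring.
  by rewrite st3.
exists (Num.sqrt (3 * (3 / pi ^+ 2))) => x y.
rewrite abc !inE => /orP[/orP[]|] /eqP -> /orP[/orP[]|] /eqP ->; rewrite ?eqxx// => _;
  rewrite ?aE ?bE ?cE.
- by apply: (side u v w) => //; lra.
- by apply: (side u w v) => //; lra.
- by apply: (side v u w) => //; lra.
- by apply: (side v w u) => //; lra.
- by apply: (side w u v) => //; lra.
- by apply: (side w v u) => //; lra.
Qed.

(* The first coordinates of the vertices of the triangles fill [-r, r]. *)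
Lemma uncountable_triangles (A : set {fset R * R}) :
  (forall u : R * R, unitv u -> A (triangle u)) -> ~ countable A.
Proof.
move=> At cA; have pi0 := @pi_gt0 R.
have r0 : 0 < r :> R by rewrite divr_gt0// sqrtr_gt0.
pose B := \bigcup_(alpha in A) (fst @` [set` alpha]).
have cB : countable B.
  apply: bigcup_countable => // alpha _.
  by apply: sub_countable (card_image_le _ _) _; apply: finite_set_countable.
have sB : `[- r, r] `<=` B.
  move=> x /=; rewrite in_itv/= => xr.
  have x1 : (x / r) ^+ 2 <= 1.
    rewrite -[_ ^+ 2]real_normK ?num_real// expr_le1// normf_div (gtr0_norm r0).
    by rewrite ler_pdivrMr// mul1r ler_norml.
  pose u := (x / r, Num.sqrt (1 - (x / r) ^+ 2)).
  exists (triangle u).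
    by apply: At; rewrite /= sqr_sqrtr ?subr_ge0// addrC subrK.
  exists (r * u.1, r * u.2) => /=; first by rewrite !inE eqxx.
  by rewrite mulrC divfK// gt_eqF.
(* A countable set is Lebesgue null, but this interval has measure 2 r > 0. *)
have := countable_lebesgue_measure0 (sub_countable (subset_card_le sB) cB).
rewrite /= lebesgue_measure_itv/= lte_fin gtrN//.
by rewrite -EFinD opprK => -[]; move: r r0 => s s0; lra.
Qed.

Lemma error_bound : (`|(2^-1 - 3 / pi ^+ 2)%:E - (196 / 10 ^+ 3 + 36 / 10 ^+ 6)%:E|
  < (1 / 10 ^+ 6 : R)%:E)%E.
Proof.
rewrite -EFinD lte_fin; move: (pi : R) (@pi_gt0 R) (@pi_bounds R) => p p0 /andP[pl pu].
have sq (x y : R) : 0 <= x -> x < y -> x ^+ 2 <= y ^+ 2.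
  by move=> x0 xy; rewrite lerXn2r ?nnegrE ?(ltW xy)// (le_trans x0)// ltW.
have pl2 : (6 * (523 / 10 ^+ 3 + 598 / 10 ^+ 6)) ^+ 2 <= p ^+ 2.
  by apply: sq pl; lra.
have pu2 := sq _ _ (ltW p0) pu.
have p20 : 0 < p ^+ 2 by rewrite exprn_gt0.
(* The tolerance asks for 3 / pi^2 strictly between 0.303963 and 0.303965, the endpoints of 0.5 -
   0.196036 plus or minus 10^-6. *)
have h1 : 3 / p ^+ 2 < 303 / 10 ^+ 3 + 965 / 10 ^+ 6 by rewrite ltr_pdivrMr//; lra.
have h2 : 303 / 10 ^+ 3 + 963 / 10 ^+ 6 < 3 / p ^+ 2 by rewrite ltr_pdivlMr//; lra.
by rewrite ltr_norml; apply/andP; split; lra.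
Qed.

End conclusion.

Theorem theorem2p8p1 (R : realType) :
  (forall alpha : {fset R * R},
     optimal_means (@uniform_disc R) 3 alpha ->
     voronoi_sector_partition (2 * pi / 3) alpha) ->
  [/\ ~ countable [set alpha : {fset R * R} |
                     optimal_means (@uniform_disc R) 3 alpha],
      (`| quantization_error (@uniform_disc R) 3
          - (196 / 10 ^+ 3 + 36 / 10 ^+ 6)%:E | < (1 / 10 ^+ 6)%:E)%E
    & forall alpha : {fset R * R},
        optimal_means (@uniform_disc R) 3 alpha ->
        equilateral_triangle alpha /\ inscribed_in_circle (3 / pi ^+ 2) alpha].
Proof.
move=> sectors.
(* This single optimal set provides the value of V_3 and the moments of the wedge; with them every
   triangle attains V_3. *)
have [alpha0 opt0] := @exists_optimal R.
have [a [b [c [u [v [w st0]]]]]] := sector_structureP _ opt0.1 (sectors _ opt0).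
have [VE _ _ _] := optimal_sectors _ _ _ _ _ _ _ opt0 st0.
have [q m _ _] := sector_moments _ _ _ _ _ _ _ st0.
split.
- apply: uncountable_triangles => t t1; split; first exact: card_fset3_le3.
  apply/eqP; rewrite eq_le quantization_error_le ?card_fset3_le3// andbT VE.
  exact: triangle_distortion.
- by rewrite VE; exact: error_bound.
- move=> alpha opt.
  have [a' [b' [c' [u' [v' [w' st]]]]]] := sector_structureP _ opt.1 (sectors _ opt).
  exact: optimal_triangle opt st.
Qed.
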